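(* Let $B=L^p(\mathbb R)$ for some fixed $p$, $1\le p\le\infty$, or $B=CB(\mathbb R)$ (real-valued functions). Suppose that $(\phi_n)$ is a proper approximate identity and $(\epsilon_n)$ is a sequence of positive numbers with $\lim_{n\to\infty}\epsilon_n=0$. Then there is a dense $G_\delta$ subset $\mathcal A$ of $B$ such that for all $f\in\mathcal A$ we have both $$\limsup_{n\to\infty}\frac{\phi_n\star f(x)-f(x)}{\epsilon_n}=\infty\ \text{ for a.e. }x\in\mathbb R\quad\text{and}\quad \liminf_{n\to\infty}\frac{\phi_n\star f(x)-f(x)}{\epsilon_n}=-\infty\ \text{ for a.e. }x\in\mathbb R .$$
   Context: $\phi\star f(x)=\int_{-\infty}^{\infty}\phi(y)f(x-y)\,d\lambda(y)$ with $\lambda$ Lebesgue measure. $CB(\mathbb R)$ is the space of continuous bounded functions on $\mathbb R$ with the uniform norm; $L^p(\mathbb R)$ carries its usual norm. An approximate identity is a sequence $(\phi_n)$ in $L^1(\mathbb R)$ such that $\lim_{n\to\infty}\|\phi_n\star f-f\|_1=0$ for all $f\in L^1(\mathbb R)$. It is normalized if $\|\phi_n\|_1=1$ for all $n\ge1$. It is eventually local if all $\phi_n$ have bounded support and for every $\delta>0$ there is $N\ge1$ such that for all $n\ge N$, $\phi_n(x)=0$ for a.e. $x\in\mathbb R\setminus[-\delta,\delta]$. A proper approximate identity is a normalized, eventually local approximate identity consisting of positive (i.e. nonnegative) functions. *)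

(* Defs.v *)
From HB Require Import structures.
From mathcomp Require Import all_boot all_order all_algebra.
From mathcomp Require Import all_classical all_reals all_analysis.
From mathcomp Require Import measurable_realfun borel_hierarchy.

Set Implicit Arguments.
Unset Strict Implicit.
Unset Printing Implicit Defensive.

Import Order.TTheory GRing.Theory Num.Def Num.Theory.
Import numFieldNormedType.Exports.

Local Open Scope classical_set_scope.
Local Open Scope ring_scope.

(* The library defines the quotient type [LspaceType mu p1] but puts no
   topology on it; we equip it with the metric of the [Lp] norm. *)
Section Lspace_metric.
Context d (T : measurableType d) (R : realType).
Variables (mu : {measure set T -> \bar R}) (p : \bar R) (p1 : (1 <= p)%E).
Implicit Types f g h : LspaceType mu p1.

HB.instance Definition _ := gen_eqMixin (LspaceType mu p1).
HB.instance Definition _ := gen_choiceMixin (LspaceType mu p1).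

Definition Lspace_dist f g : R := fine ('N[mu]_p[EFin \o (f \- g)%R])%E.

Let Lspace_mfun f : measurable_fun [set: T] (f : T -> R).
Proof. exact: (@measurable_funPT _ _ _ _ (repr (LebesgueSpace.sort f))). Qed.

Let finite_normB (u v : T -> R) :
  measurable_fun [set: T] u -> measurable_fun [set: T] v ->
  finite_norm mu p u -> finite_norm mu p v -> finite_norm mu p (u \- v).
Proof.
move=> mu_ mv fu fv; have mNv : measurable_fun [set: T] (\- v).
  exact: measurableT_comp.
rewrite /finite_norm (le_lt_trans (eminkowski mu mu_ mNv p1))//.
rewrite -[EFin \o (\- v)%R]/(\- (EFin \o v))%E.
by rewrite oppe_Lnorm lte_add_pinfty.
Qed.

Let Lspace_dist_fin f g :
  (Lspace_dist f g)%:E = ('N[mu]_p[EFin \o (f \- g)%R])%E.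
Proof.
rewrite /Lspace_dist fineK// ge0_fin_numE ?Lnorm_ge0//.
by apply: finite_normB;
  [exact: Lspace_mfun..|exact: Lebesgue_finite|exact: Lebesgue_finite].
Qed.

Let Lspace_dist_eq0 f g : Lspace_dist f g = 0 -> f = g.
Proof.
move=> fg0; have := Lspace_dist_fin f g; rewrite fg0 => /esym N0.
have fg := Lnorm_eq0_eq0 ((measurable_EFinP _ _).2
  (measurable_funB (Lspace_mfun f) (Lspace_mfun g))) (lt_le_trans lte01 p1) N0.
have {}fg : LebesgueSpace.sort f = LebesgueSpace.sort g.
  rewrite -[LHS]reprK -[RHS]reprK; apply/eqmodP/asboolP.
  apply: filterS fg => x /= /(_ I) [] /eqP; rewrite subr_eq0 => /eqP.
  by move=> + _.
case: f g fg {fg0 N0} => [f [[cf]]] [g [[cg]]] /= fg.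
by case: _ / fg cg => cg; rewrite (Prop_irrelevance cf cg).
Qed.

Let Lspace_distxx f : Lspace_dist f f = 0.
Proof.
rewrite /Lspace_dist (_ : _ \o _ = cst 0%E) ?Lnorm0//.
  by rewrite gt_eqF// (lt_le_trans _ p1).
by apply/funext => x /=; rewrite subrr.
Qed.

Let Lspace_distC f g : Lspace_dist f g = Lspace_dist g f.
Proof.
rewrite /Lspace_dist -oppe_Lnorm; congr (fine (Lnorm _ _ _)).
by apply/funext => x /=; rewrite /= opprB.
Qed.

Let Lspace_dist_triangle g f h :
  Lspace_dist f h <= Lspace_dist f g + Lspace_dist g h.
Proof.
rewrite -lee_fin EFinD !Lspace_dist_fin.
rewrite (_ : (f \- h)%R = ((f \- g) \+ (g \- h))%R).
  by apply: eminkowski => //; apply: measurable_funB; exact: Lspace_mfun.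
by apply/funext => x /=; rewrite addrA subrK.
Qed.

HB.instance Definition _ := isMetric.Build R (LspaceType mu p1)
  Lspace_distxx Lspace_dist_eq0 Lspace_distC Lspace_dist_triangle.

End Lspace_metric.

Record CB (R : realType) := MkCB {
  CB_fun :> R -> R ;
  CB_continuous : continuous CB_fun ;
  CB_bounded : bounded_fun CB_fun }.

Section CB_metric.
Context (R : realType).
Implicit Types f g h : CB R.

HB.instance Definition _ := gen_eqMixin (CB R).
HB.instance Definition _ := gen_choiceMixin (CB R).

Definition CB_dist f g : R := sup (range (fun x => `|f x - g x|)).

Let CB_dist_sup f g : has_sup (range (fun x => `|f x - g x|)).
Proof.
split; first by exists `|f 0 - g 0|; exists 0.
have [M [_ fM]] := CB_bounded f; have [N [_ gN]] := CB_bounded g.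
exists (M + 1 + (N + 1)) => _ [x _ <-].
by rewrite (le_trans (ler_normB _ _))// lerD// ?fM ?gN// ltrDl.
Qed.

Let CB_dist_ub f g x : `|f x - g x| <= CB_dist f g.
Proof. by apply: (sup_upper_bound (CB_dist_sup f g)); exists x. Qed.

Let CB_dist_le f g (M : R) : (forall x, `|f x - g x| <= M) -> CB_dist f g <= M.
Proof.
move=> fgM; apply: ge_sup; first by case: (CB_dist_sup f g).
by move=> _ [x _ <-].
Qed.

Let CB_distxx f : CB_dist f f = 0.
Proof.
apply/eqP; rewrite eq_le; apply/andP; split.
  by apply: CB_dist_le => x; rewrite subrr normr0.
by apply: le_trans (CB_dist_ub f f 0); exact: normr_ge0.
Qed.

Let CB_dist_eq0 f g : CB_dist f g = 0 -> f = g.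
Proof.
move=> fg0; have {fg0} : f = g :> (R -> R).
  apply/funext => x; apply/eqP; rewrite -subr_eq0 -normr_le0 -fg0.
  exact: CB_dist_ub.
case: f g => [f cf bf] [g cg bg] /= fg.
by case: _ / fg cg bg => cg bg; congr MkCB; exact: Prop_irrelevance.
Qed.

Let CB_distC f g : CB_dist f g = CB_dist g f.
Proof.
rewrite /CB_dist (_ : (fun x => _) = fun x => `|g x - f x|)//.
by apply/funext => x; rewrite distrC.
Qed.

Let CB_dist_triangle g f h : CB_dist f h <= CB_dist f g + CB_dist g h.
Proof.
apply: CB_dist_le => x; rewrite (le_trans (ler_distD (g x) _ _))//.
by rewrite lerD// CB_dist_ub.
Qed.

HB.instance Definition _ := isMetric.Build R (CB R)
  CB_distxx CB_dist_eq0 CB_distC CB_dist_triangle.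

End CB_metric.

Section approximate_identity.
Context (R : realType).
Local Notation mu := (@lebesgue_measure R).
Local Notation L1 := (LspaceType1 mu).

(* [Rintegral] takes a junk value where [y |-> phi y * f (x - y)] is not
   integrable; for [phi] in [L1] with bounded support and [f] in [Lp] or [CB]
   this happens only for [x] in a null set. *)
Definition convolution (phi f : R -> R) (x : R) : R :=
  \int[mu]_y (phi y * f (x - y)).

Definition approximate_identity (phi : nat -> L1) : Prop :=
  forall f : L1,
    'N[mu]_1[EFin \o (convolution (phi n) f \- f)%R]%E @[n --> \oo] --> 0%E.

Definition normalized (phi : nat -> L1) : Prop :=
  forall n, ('N[mu]_1[EFin \o phi n] = 1)%E.

(* For a class modulo a.e. equality, bounded support means vanishing a.e.
   outside some bounded interval. *)
Definition bounded_support (f : L1) : Prop :=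
  exists M : R, \forall x \ae mu, x \notin `[- M, M] -> f x = 0.

Definition eventually_local (phi : nat -> L1) : Prop :=
  (forall n, bounded_support (phi n)) /\
  forall delta : R, 0 < delta -> exists N : nat, forall n, (N <= n)%N ->
    \forall x \ae mu, x \notin `[- delta, delta] -> phi n x = 0.

Definition proper_approximate_identity (phi : nat -> L1) : Prop :=
  [/\ approximate_identity phi, normalized phi, eventually_local phi &
      forall n, \forall x \ae mu, 0 <= phi n x].

Definition ae_oscillates (phi : nat -> L1) (eps : nat -> R) (f : R -> R) :=
  let q n x := ((convolution (phi n) f x - f x) / eps n)%:E in
  (\forall x \ae mu, limn_esup (q ^~ x) = +oo%E) /\
  (\forall x \ae mu, limn_einf (q ^~ x) = -oo%E).

End approximate_identity.

(* Main.v *)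
(* For [f] in [B] with perturbation [u], [phi_n * u - u >= c] off a small set as soon
   as [u >= 0] is a comb of thin spikes: [u] vanishes outside a set of small measure,
   while [phi_n * u] is almost constant, hence close to the mean of [u], once the
   period of the comb is small compared with the modulus of continuity of
   [s |-> phi_n (. - s)] in [L1]. The amplitude and the density of [u], hence [c], are
   fixed first, [n] next and the period last, so that [eps_n] and [phi_n * f - f], which
   tends to 0 in measure on bounded sets, are both negligible with respect to [c]. By Young's inequality the resulting lower bound
   on [(phi_n * f - f) / eps_n] survives a small change of [f] in [B], so it defines
   sets with dense interior; [A] is the intersection of these interiors. Baire's
   theorem is not applied in [B] but to [h |-> F + w h], [h] in [CB], where
   [w x = 1 / (1 + x^2)] belongs to every [Lp]; only the completeness of [CB] is used. *)
Require Import Defs.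
From HB Require Import structures.
From mathcomp Require Import all_boot all_order all_algebra.
From mathcomp Require Import all_classical all_reals all_analysis borel_hierarchy.
From mathcomp Require Import measurable_realfun ess_sup_inf lra ring.
Import Order.TTheory GRing.Theory Num.Def Num.Theory.
Import numFieldNormedType.Exports.
Local Open Scope classical_set_scope.
Local Open Scope ring_scope.

(** * Convolution on the real line *)

#[local] Instance lebesgue_ae_filter (R : realType) :
  Filter (almost_everywhere (@lebesgue_measure R)).
Proof. exact: ae_filter_ringOfSetsType. Qed.

Section reflection.
Context {R : realType}.
Local Notation mu := (@lebesgue_measure R).
Implicit Types (c : R) (F : R -> \bar R).

(** Lebesgue measure is determined by its values on half-open intervals, and the reflection carries
    such an interval to one of the same length, with the closed end on the other side. *)
Lemma lebesgue_measure_reflection c (A : set R) : measurable A ->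
  mu ((fun y => c - y) @^-1` A) = mu A.
Proof.
move=> mA.
have mr : measurable_fun [set: measurableTypeR R] (fun y : R => c - y).
  exact: measurable_funB.
have {}mr : measurable_fun [set: measurableTypeR R]
    ((fun y : R => c - y) : measurableTypeR R -> measurableTypeR R) by [].
pose mr_mixin := isMeasurableFun.Build _ _ _ _ _ mr.
pose r : {mfun measurableTypeR R >-> measurableTypeR R} := HB.pack (fun y : R => c - y) mr_mixin.
apply/esym.
apply: (@lebesgue_measure_unique _ (pushforward mu r)) => // _ [[a b]] _ <-/=.
rewrite /pushforward/= (_ : _ @^-1` _ = `[c - b, c - a[%classic).
  rewrite !lebesgue_measure_itv/= !lte_fin ltrD2l ltrN2.
  by case: ifP => // _; rewrite -!EFinB; congr EFin; ring.
apply/seteqP; split => y /=; rewrite !in_itv/= => /andP[? ?]; apply/andP; split; lra.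
Qed.

Lemma ge0_integral_reflection c F : measurable_fun [set: R] F ->
  (forall y, 0 <= F y)%E -> (\int[mu]_y F (c - y)%R = \int[mu]_y F y)%E.
Proof.
move=> mF F0.
have mr : measurable_fun [set: measurableTypeR R] (fun y : R => c - y).
  exact: measurable_funB.
have := @ge0_integral_pushforward _ _ (measurableTypeR R) (measurableTypeR R) R
  _ mr mu setT F measurableT mF (fun y _ => F0 y).
rewrite preimage_setT => <-.
by apply: eq_measure_integral => A mA _; exact: lebesgue_measure_reflection.
Qed.

Lemma ae_reflection c (P : R -> Prop) :
  (\forall y \ae mu, P y) -> \forall y \ae mu, P (c - y).
Proof.
move=> [A [mA A0 PA]]; exists ((fun y => c - y) @^-1` A); split.
- rewrite -[_ @^-1` _]setTI; exact: measurable_funB.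
- by rewrite -A0; apply: lebesgue_measure_reflection.
- by move=> y /= nP; apply: PA.
Qed.

End reflection.

(** * Tonelli's theorem and Young's inequality for convolutions *)

Section young.
Context {R : realType}.
Local Notation mu := (@lebesgue_measure R).
Implicit Types (phi v f : R -> R).

(** A translation is the composite of two reflections: [y - c = 0 - (c - y)]. *)
Lemma ge0_integral_translation (c : R) (F : R -> \bar R) :
  measurable_fun [set: R] F -> (forall y, 0 <= F y)%E ->
  (\int[mu]_y F (y - c)%R = \int[mu]_y F y)%E.
Proof.
move=> mF F0; rewrite -[RHS](ge0_integral_reflection 0)//.
rewrite -(ge0_integral_reflection c (F \o (fun y => 0 - y)))/=; last 2 first.
- by apply: measurableT_comp => //; exact: measurable_funB.
- by move=> y; exact: F0.
by apply: eq_integral => y _ /=; rewrite sub0r opprB.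
Qed.

Lemma measurable_conv_integrand phi v : measurable_fun [set: R] phi ->
  measurable_fun [set: R] v ->
  measurable_fun [set: measurableTypeR R * measurableTypeR R]
    (fun z => phi z.2 * v (z.1 - z.2)).
Proof.
move=> mphi mv; apply: measurable_funM.
  exact: (measurableT_comp mphi measurable_snd).
by apply: (measurableT_comp mv); apply: measurable_funB;
  [exact: measurable_fst|exact: measurable_snd].
Qed.

Lemma measurable_conv_abs phi v : measurable_fun [set: R] phi ->
  measurable_fun [set: R] v ->
  measurable_fun [set: R]
    (fun x => \int[mu]_y `|(phi y * v (x - y))%:E|)%E.
Proof.
move=> mphi mv.
apply: (@measurable_fun_fubini_tonelli_F _ _ (measurableTypeR R)
  (measurableTypeR R) R mu (fun z => `|(phi z.2 * v (z.1 - z.2))%:E|%E)) => //.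
by apply: measurableT_comp => //; apply/measurable_EFinP;
  exact: (measurable_conv_integrand phi v mphi mv).
Qed.

(** Tonelli exchanges the integrals, and translation invariance turns the inner one into the norm of
    [v]. Everything is nonnegative, so infinite values are allowed; finiteness of the right-hand
    side later yields absolute convergence. *)
Lemma integral_conv_abs phi v : measurable_fun [set: R] phi ->
  measurable_fun [set: R] v ->
  (\int[mu]_x \int[mu]_y `|(phi y * v (x - y))%:E| =
   \int[mu]_y `|(phi y)%:E| * \int[mu]_y `|(v y)%:E|)%E.
Proof.
move=> mphi mv.
rewrite (fubini_tonelli (m1 := mu) (m2 := mu)
  (fun z => `|(phi z.2 * v (z.1 - z.2))%:E|%E))//=; last first.
  apply/measurable_EFinP; apply: measurableT_comp => //.
  exact: (measurable_conv_integrand phi v mphi mv).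
rewrite -ge0_integralZr//; [|by do 2 apply: measurableT_comp => //|by apply: integral_ge0].
apply: eq_integral => y _.
under eq_integral do rewrite normrM EFinM.
rewrite ge0_integralZl//; last first.
  apply: measurableT_comp => //; apply: measurableT_comp => //.
  by apply: measurableT_comp => //; exact: measurable_funB.
congr (_ * _)%E.
rewrite (ge0_integral_translation y (fun y => `|v y|%:E))//.
by do 2 apply: measurableT_comp => //.
Qed.

Lemma measurable_convolution phi v : measurable_fun [set: R] phi ->
  measurable_fun [set: R] v ->
  mu.-integrable setT (EFin \o phi) -> mu.-integrable setT (EFin \o v) ->
  measurable_fun [set: R] (convolution phi v).
Proof.
move=> mphi mv iphi iv; apply: measurableT_comp => //.
apply: (@measurable_fubini_F _ _ (measurableTypeR R)
  (measurableTypeR R) R mu mu (fun z => (phi z.2 * v (z.1 - z.2))%:E)).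
have mz := measurable_conv_integrand _ _ mphi mv.
apply/integrable12ltyP; first exact/measurable_EFinP.
rewrite -[ltLHS]/(\int[mu]_x \int[mu]_y `|(phi y * v (x - y))%:E|)%E.
rewrite integral_conv_abs//; apply: lte_mul_pinfty.
- exact: integral_ge0.
- by rewrite ge0_fin_numE ?integral_ge0//; case/integrableP : iphi.
- by case/integrableP : iv.
Qed.

(** Chebyshev's inequality combined with Young's. The absolute value stands inside the integral, so
    that off this set the convolution is both small and a convergent integral rather than a junk
    value. *)
Lemma le_measure_conv_abs phi v (e : R) : 0 < e ->
  measurable_fun [set: R] phi -> measurable_fun [set: R] v ->
  (\int[mu]_y `|(phi y)%:E| <= 1)%E ->
  (mu [set x | e%:E <= \int[mu]_y `|(phi y * v (x - y))%:E|]
    <= e^-1%:E * \int[mu]_y `|(v y)%:E|)%E.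
Proof.
move=> e0 mphi mv phi1; rewrite lee_pdivlMl//.
have := le_integral_abse mu measurableT
  (measurable_conv_abs _ _ mphi mv) e0.
rewrite setTI => /le_trans => - H.
rewrite [X in mu X](_ : _ = [set x |
    (`|(\int[mu]_y `|(phi y * v (x - y))%:E|)| >= e%:E)%E]); last first.
  by apply/seteqP; split => x /=; rewrite gee0_abs// integral_ge0.
apply: H; under eq_integral do rewrite gee0_abs ?integral_ge0//.
by rewrite integral_conv_abs// -[leRHS]mul1e lee_wpmul2r// integral_ge0.
Qed.

Lemma le_measure_norm v (e : R) : 0 < e -> measurable_fun [set: R] v ->
  (mu [set x | (e <= `|v x|)%R] <= e^-1%:E * \int[mu]_y `|(v y)%:E|)%E.
Proof.
move=> e0 mv; rewrite lee_pdivlMl//.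
have := le_integral_abse mu measurableT
  ((measurable_EFinP _ _).2 mv) e0.
by rewrite setTI; congr (_ * mu _ <= _)%E; apply/seteqP; split => x /=; rewrite lee_fin.
Qed.

End young.

(** * Combs of thin spikes *)

Section translation.
Context {R : realType}.
Local Notation mu := (@lebesgue_measure R).
Implicit Types (phi psi : R -> R).

(** The map [(y, s) |-> psi (y - s) - psi y] is jointly continuous and vanishes at [s = 0];
    compactness of [K] makes the neighbourhood of 0 independent of [y]. *)
Lemma continuous_compact_unif_translation psi (K : set R) (e : R) :
  continuous psi -> compact K -> 0 < e ->
  \forall s \near (0 : R), forall y, K y -> `|psi (y - s) - psi y| < e.
Proof.
move=> cpsi /compact_near_coveringP cK e0.
apply: (cK _ (nbhs (0 : R)) (fun s y => `|psi (y - s) - psi y| < e)) => y Ky.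
have cd : (fun z : R * R => psi (z.1 - z.2) - psi z.1) z @[z --> (y, 0)] --> (0 : R).
  rewrite -[X in _ --> X](subrr (psi y)); apply: cvgB.
    apply: (continuous_cvg _ (cpsi y)).
    rewrite -[X in _ --> X](subr0 y).
    by apply: cvgB; [exact: cvg_fst|exact: cvg_snd].
  by apply: (continuous_cvg _ (cpsi y)); exact: cvg_fst.
move/cvgrPdist_lt : cd => /(_ _ e0); apply: filterS => -[y' s] /=.
by rewrite sub0r normrN.
Qed.

(** Approximation in L1 by a continuous function, for which translation is uniformly continuous on
    compact sets. *)
Lemma L1_translation_continuous phi (e : R) : measurable_fun [set: R] phi ->
  mu.-integrable setT (EFin \o phi) -> (forall y, 1 < `|y| -> phi y = 0) ->
  0 < e -> \forall s \near (0 : R),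
    (\int[mu]_y `|(phi (y - s) - phi y)%:E| <= e%:E)%E.
Proof.
move=> mphi iphi phi0 e0; pose I := `[(-3)%R, 3%R : R]%classic.
have mI : measurable I by exact: measurable_itv.
have muI : (mu I < +oo)%E.
  by rewrite lebesgue_measure_itv/=; case: ifP => // _; rewrite -EFinB ltry.
have iI : mu.-integrable I (EFin \o phi) by apply: integrableS iphi.
have [g [cg ig gcvg]] := approximation_continuous_integrable mI muI iI.
have e40 : 0 < e / 4 by rewrite divr_gt0.
have [N _ /(_ N (leqnn N)) /=] : \forall n \near \oo,
    (\int[mu]_(z in I) `|(phi z - g n z)%:E| < (e / 4)%:E)%E.
  by apply: (gcvg _ (@open_ereal_lt' _ 0%E (e / 4)%:E _)); rewrite lte_fin.
move: (g N) (cg N) (ig N) => {g cg ig gcvg} psi cpsi ipsi gN.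
pose D y := `|(phi y - psi y) * \1_I y|.
have mpsi : measurable_fun [set: R] psi by exact: continuous_measurable_fun.
have mD : measurable_fun [set: R] D.
  apply: measurableT_comp => //; apply: measurable_funM => //.
  exact: measurable_funB.
have D0 y : 0 <= D y by exact: normr_ge0.
have ID : (\int[mu]_y (D y)%:E <= (e / 4)%:E)%E.
  apply: le_trans (ltW gN).
  rewrite [leRHS]integral_mkcond le_eqVlt; apply/orP; left; apply/eqP.
  apply: eq_integral => y _; rewrite /D patchE indicE; case: ifPn => yI.
    by rewrite mulr1.
  by rewrite mulr0 normr0.
have e80 : 0 < e / 8 by rewrite divr_gt0.
have K2 : compact (`[(-2)%R, 2%R : R]%classic) by exact: segment_compact.
have := continuous_compact_unif_translation _ _ _ cpsi K2 e80.
have : \forall s \near (0 : R), `|s| < 1 by exact: nbhs0_lt.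
apply: filterS2 => s s1 us.
(* The first two terms are approximation errors, of integral at most [e / 4] each; the third bounds
   the translation of [psi], and its integral is [e / 8] times the length 4. *)
have bound y : `|phi (y - s) - phi y| <=
    D (y - s) + D y + e / 8 * \1_(`[(-2)%R, 2%R : R]%classic) y.
  rewrite /D !indicE /=.
  have [y2|y2] := boolP (y \in `[(-2)%R, 2%R : R]%classic); last first.
    have y2' : 2 < `|y|.
      by move: y2; rewrite notin_setE/= in_itv/= -ler_norml => /negP; rewrite -ltNge.
    have ? := lerB_dist y s.
    rewrite !phi0; [|lra|lra].
    rewrite subrr normr0 !addr_ge0 ?mulr_ge0//; lra.
  have /andP[yl yu] : -2 <= y <= 2 by have := set_mem y2; rewrite /= in_itv.
  move: (s1); rewrite ltr_norml => /andP[sl su].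
  rewrite !mem_set ?mulr1/=; [|rewrite /I/= in_itv/=; lra..].
  have := us y; rewrite /= in_itv/= yl yu => /(_ isT) /ltW {}us.
  rewrite (_ : phi (y - s) - phi y = (phi (y - s) - psi (y - s)) +
     (psi (y - s) - psi y) - (phi y - psi y)); last by ring.
  rewrite (le_trans (ler_normB _ _))// (le_trans (lerD (ler_normD _ _) (lexx _)))//.
  by rewrite -addrA [leRHS]addrAC -!addrA lerD2l; lra.
have mDs : measurable_fun [set: R] (fun y => D (y - s)).
  by apply: measurableT_comp => //; exact: measurable_funB.
have mJ : measurable_fun [set: R] (\1_(`[(-2)%R, 2%R : R]%classic) : R -> R).
  by apply: measurable_indic; exact: measurable_itv.
have m1 : measurable_fun [set: R] (fun y => e / 8 * \1_(`[(-2)%R, 2%R : R]%classic) y).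
  exact: measurable_funM.
apply: (@le_trans _ _ (\int[mu]_y ((D (y - s))%:E + (D y)%:E +
    (e / 8 * \1_(`[(-2)%R, 2%R : R]%classic) y)%:E)))%E.
  apply: ge0_le_integral => //=.
  - apply/measurable_EFinP; apply: measurableT_comp => //.
    apply: measurable_funB => //.
    by apply: measurableT_comp => //; exact: measurable_funB.
  - by apply/measurable_EFinP; apply: measurable_funD => //; apply: measurable_funD.
  - by move=> y _; rewrite -!EFinD lee_fin.
rewrite ge0_integralD//; last 4 first.
- by move=> y _; rewrite -EFinD lee_fin addr_ge0.
- by apply/measurable_EFinP; apply: measurable_funD.
- by move=> y _; rewrite lee_fin mulr_ge0// ltW.
- exact/measurable_EFinP.
rewrite ge0_integralD//; last 4 first.
- by move=> y _; rewrite lee_fin.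
- exact/measurable_EFinP.
- by move=> y _; rewrite lee_fin.
- exact/measurable_EFinP.
rewrite (ge0_integral_translation s (EFin \o D))//; last exact/measurable_EFinP.
under [X in (_ + X)%E]eq_integral do rewrite EFinM.
rewrite ge0_integralZl//; last 2 first.
- exact/measurable_EFinP.
- by rewrite lee_fin ltW.
rewrite integral_indic//.
have muJ : (mu `[(-2)%R, 2%R : R]%classic <= 4%:E)%E.
  by rewrite lebesgue_measure_itv/= lte_fin; case: ifP => _; rewrite ?lee_fin; lra.
apply: (@le_trans _ _ ((e / 4)%:E + (e / 4)%:E + (e / 8)%:E * 4%:E)%E).
  rewrite !leeD// lee_wpmul2l ?lee_fin ?(ltW e80)//.
  by rewrite setIT; exact: muJ.
by rewrite -EFinM -!EFinD lee_fin; lra.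
Qed.
End translation.

Section spikes.
Context {R : realType}.
Local Notation mu := (@lebesgue_measure R).
Implicit Types (L sigma t x : R) (j M : nat).

(** A continuous substitute for the indicator of the cell [[0, 1]]: at least 1/2 on the cell and
    zero outside [[-1/2, 3/2]]. *)
Definition hat t : R := maxr 0 (1 - `|t - 2^-1|).

(** The line is cut, from [- L] on, into cells of length [sigma], and one cell out of [j] carries a
    tent. A maximum instead of a sum keeps the values below 1 even where tents overlap. *)
Definition spikes L sigma j M x : R :=
  \big[maxr/0]_(m < M.+1) hat ((x + L) / sigma - (m * j)%:R).

Lemma hat_le1 t : hat t <= 1.
Proof. by rewrite ge_max ler01 lerBlDr lerDl normr_ge0. Qed.

Lemma hat_eq0 t : ~ (- 2^-1 <= t <= 3 / 2) -> hat t = 0.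
Proof.
move=> th; apply/max_idPl; rewrite subr_le0 leNgt; apply/negP => H; apply: th.
by move: H; rewrite ltr_norml => /andP[? ?]; apply/andP; split; lra.
Qed.

Lemma hat_ge_half t : 0 <= t <= 1 -> 2^-1 <= hat t.
Proof.
move=> /andP[t0 t1]; rewrite le_max; apply/orP; right.
by rewrite lerBrDr -lerBrDl ler_norml; apply/andP; split; lra.
Qed.

Lemma continuous_hat : continuous hat.
Proof.
move=> t; apply: (@continuous_max _ _ (cst 0) (fun t => 1 - `|t - 2^-1|)).
  exact: cst_continuous.
apply: cvgB; first exact: cvg_cst.
by apply: cvg_norm; apply: cvgB; [exact: cvg_id|exact: cvg_cst].
Qed.

Lemma spikes_ge0 L sigma j M x : 0 <= spikes L sigma j M x.
Proof. exact: bigmax_ge_id. Qed.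

Lemma spikes_le1 L sigma j M x : spikes L sigma j M x <= 1.
Proof. by apply: bigmax_le => // i _; exact: hat_le1. Qed.

Lemma continuous_spikes L sigma j M : continuous (spikes L sigma j M).
Proof.
apply: continuous_big => [z|m _ x]; first exact: max_continuous.
apply: (continuous_cvg _ (continuous_hat _)).
apply: cvgB; last exact: cvg_cst.
by apply: cvgM; [apply: cvgD; [exact: cvg_id|exact: cvg_cst]|exact: cvg_cst].
Qed.

Lemma spikes_neq0 L sigma j M x : spikes L sigma j M x != 0 ->
  exists2 m, (m <= M)%N & - 2^-1 <= (x + L) / sigma - (m * j)%:R <= 3 / 2.
Proof.
apply: contraNP => /forall2NP H; apply/eqP/le_anti; rewrite spikes_ge0 andbT.
apply: bigmax_le => // m _; rewrite hat_eq0//.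
by have [] := H m => // /negP; rewrite -ltnNge ltnNge -ltnS ltn_ord.
Qed.

(** If [z] lies in the cell of index [l], moving it back by [l %% j] cells puts it in the cell of
    index [(l %/ j) * j], which carries a spike. *)
Lemma spikes_cover L sigma j M z : 0 < sigma -> (0 < j)%N ->
  - L <= z -> z + L <= sigma * (M * j)%:R ->
  exists2 i, (i < j)%N & 2^-1 <= spikes L sigma j M (z - i%:R * sigma).
Proof.
move=> s0 j0 zL zM; set t := (z + L) / sigma.
have t0 : 0 <= t by apply: divr_ge0; [lra|exact: ltW].
have tM : t <= (M * j)%:R by rewrite ler_pdivrMr// mulrC.
have := truncn_itv t0; set l := truncn t => /andP[lt tl].
have lM : (l %/ j < M.+1)%N.
  rewrite ltnS -(@leq_pmul2r j)//; apply: leq_trans (leq_trunc_div _ _) _.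
  by rewrite -(ler_nat R); apply: le_trans tM.
exists (l %% j)%N; first by rewrite ltn_pmod.
apply: le_trans (le_bigmax _ _ (Ordinal lM)) => /=; apply: hat_ge_half.
rewrite (_ : _ - _ = t - l%:R).
  by rewrite subr_ge0 lt/= lerBlDl natr1 ltW.
rewrite [X in _ = _ - X%:R](divn_eq l j) natrD /t.
by field; rewrite gt_eqF.
Qed.
End spikes.

(** * Convolution of a kernel with a comb *)

Section oscillation.
Context {R : realType}.
Local Notation mu := (@lebesgue_measure R).
Implicit Types (phi u : R -> R).

(** An everywhere-defined representative of [phi n] for large [n]: sign and support conditions hold
    at every point, not only almost everywhere. *)
Definition unit_kernel phi := [/\ measurable_fun [set: R] phi,
  mu.-integrable setT (EFin \o phi), forall y, 0 <= phi y,
  forall y, 1 < `|y| -> phi y = 0 & (\int[mu]_y (phi y)%:E = 1)%E].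

(** A change of variables moves the shift from [u] to [phi]; as [0 <= u <= 1], the error is at most
    the L1 distance between [phi] and its translate. *)
Lemma conv_translation_le phi u (x s e : R) : unit_kernel phi ->
  measurable_fun [set: R] u -> (forall x, 0 <= u x <= 1) -> 0 <= e ->
  (\int[mu]_y `|(phi (y - s) - phi y)%:E| <= e%:E)%E ->
  (\int[mu]_y (phi y * u (x - s - y))%:E <=
   \int[mu]_y (phi y * u (x - y))%:E + e%:E)%E.
Proof.
move=> [mphi iphi phi0 _ _] mu_ u01 e0 phis.
have u0 z : 0 <= u z by case/andP: (u01 z).
have u1 z : u z <= 1 by case/andP: (u01 z).
have mphis : measurable_fun [set: R] (fun y => phi (y - s)).
  by apply: measurableT_comp => //; exact: measurable_funB.
have mur c : measurable_fun [set: R] (fun y => u (c - y)).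
  by apply: measurableT_comp => //; exact: measurable_funB.
have murs : measurable_fun [set: R] (fun y => u (x - s - (y - s))).
  apply: measurableT_comp => //; apply: measurable_funB => //.
  exact: measurable_funB.
have mabs : measurable_fun [set: R] (fun y => `|phi (y - s) - phi y|).
  by apply: measurableT_comp => //; exact: measurable_funB.
rewrite -(ge0_integral_translation s
  (fun y => (phi y * u (x - s - y))%:E))/=; last 2 first.
- by apply/measurable_EFinP; exact: measurable_funM.
- by move=> y; rewrite lee_fin mulr_ge0.
apply: (@le_trans _ _ (\int[mu]_y ((phi y * u (x - y))%:E +
    `|phi (y - s) - phi y|%:E)))%E.
  apply: ge0_le_integral => //=.
  - by move=> y _; rewrite lee_fin mulr_ge0.
  - apply/measurable_EFinP; exact: measurable_funM.
  - apply/measurable_EFinP; apply: measurable_funD => //.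
    by apply: measurable_funM => //; exact: mur.
  move=> y _; rewrite -EFinD lee_fin.
  rewrite (_ : x - s - (y - s) = x - y); last by ring.
  rewrite -lerBlDl -mulrBl; apply: le_trans (ler_norm _) _.
  by rewrite normrM ler_piMr// ger0_norm.
rewrite ge0_integralD//=.
- by rewrite leeD2l.
- by move=> y _; rewrite lee_fin mulr_ge0.
- by apply/measurable_EFinP; apply: measurable_funM => //; exact: mur.
- exact/measurable_EFinP.
Qed.

(** The spikes have density of order [1 / j] and their period [j * sigma] is so short that [phi]
    cannot tell the [j] shifted combs apart. Each thus receives its share of the total, while the
    spikes themselves stay in [B]. *)
Lemma unit_kernel_oscillation phi (K : R) j : unit_kernel phi -> 0 <= K ->
  (0 < j)%N -> exists u : R -> R, exists B : set R,
  [/\ continuous u, forall x, 0 <= u x <= 1,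
      measurable B /\ (mu B <= (8 * (K + 2) / j%:R)%:E)%E,
      (forall x, ~ B x -> u x = 0) /\ (forall x, K + 4 <= `|x| -> u x = 0) &
      forall x, `|x| <= K -> (4 * j%:R)^-1 <= convolution phi u x].
Proof.
move=> kphi K0 j0; have jR : 0 < j%:R :> R by rewrite ltr0n.
have [mphi iphi phi0 phisupp phi1] := kphi.
(* Summing over [j] shifts will give [1/2 <= j * (f + e)] for the convolution value [f]; this [e]
   leaves [f >= 1 / (4 * j)]. *)
pose e : R := (4 * j%:R)^-1.
have e0 : 0 < e by rewrite invr_gt0 mulr_gt0.
have /nbhs_ballP[d /= d0 dphi] := L1_translation_continuous phi e mphi iphi phisupp e0.
pose L := K + 2.
have L0 : 0 < L by rewrite /L; lra.
(* [M] periods fill [[-L, L]]. As [M] exceeds both [2 * L] and [2 * L / d], the period is less than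
   1 and less than the modulus [d]. *)
pose M := (truncn (2 * L + 2 * L / d)).+1.
have M0 : 0 < M%:R :> R by rewrite ltr0n.
have ML : 2 * L < M%:R.
  apply: le_lt_trans (truncnS_gt _).
  by rewrite lerDl divr_ge0 ?mulr_ge0 ?ltW.
have Md : 2 * L / d < M%:R.
  apply: le_lt_trans (truncnS_gt _).
  by rewrite lerDr mulr_ge0 ?ltW.
pose sigma := 2 * L / (M * j)%:R.
have s0 : 0 < sigma by rewrite divr_gt0 ?mulr_gt0// natrM mulr_gt0.
have sj : j%:R * sigma = 2 * L / M%:R.
  by rewrite /sigma natrM; field; rewrite !gt_eqF.
have sj1 : j%:R * sigma < 1 by rewrite sj ltr_pdivrMr// mul1r.
have sjd : j%:R * sigma < d by rewrite sj ltr_pdivrMr// -ltr_pdivrMl// mulrC.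
have s1 : sigma < 1.
  by apply: le_lt_trans sj1; rewrite ler_peMl ?ler1n// ltW.
have sM : sigma * (M * j)%:R = 2 * L.
  by rewrite /sigma natrM; field; rewrite !gt_eqF.
pose u := spikes L sigma j M.
(* The left end of the support of spike [m], whose width is [2 * sigma]; the [M + 1] supports have
   total length at most [8 * L / j] because [M + 1 <= 2 * M]. *)
pose a m := - L + ((m * j)%:R - 2^-1) * sigma.
pose B := \big[setU/set0]_(m < M.+1) `[a m, a m + 2 * sigma]%classic.
have ax m x : - 2^-1 <= (x + L) / sigma - (m * j)%:R <= 3 / 2 ->
    a m <= x <= a m + 2 * sigma.
  move=> /andP[].
  rewrite lerBrDr ler_pdivlMr// lerBlDr ler_pdivrMr// => ? ?.
  by rewrite /a; apply/andP; split; lra.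
have cu : continuous u by exact: continuous_spikes.
have u01 x : 0 <= u x <= 1 by rewrite spikes_ge0 spikes_le1.
have mu_ : measurable_fun [set: R] u by exact: continuous_measurable_fun.
have ml m : mu `[a m, a m + 2 * sigma]%classic = (2 * sigma)%:E.
  rewrite lebesgue_measure_itv/= lte_fin ltrDl mulr_gt0// -EFinB.
  by congr EFin; ring.
exists u, B; split => //.
- split; first by apply: bigsetU_measurable => m _; exact: measurable_itv.
  apply: (le_trans (@Boole_inequality _ _ _ mu
    (fun m => `[a m, a m + 2 * sigma]%classic) M.+1 _)).
    by move=> i _; exact: measurable_itv.
  rewrite (eq_bigr (fun=> (2 * sigma)%:E)) => [|i _]; last exact: ml.
  rewrite sumEFin lee_fin sumr_const card_ord -[leLHS]mulr_natl.
  rewrite -/L /sigma natrM.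
  rewrite (_ : M.+1%:R * _ = (M.+1%:R / M%:R) * (4 * L / j%:R)); last first.
    by field; rewrite !gt_eqF.
  rewrite (_ : 8 * L / j%:R = 2 * (4 * L / j%:R)); last first.
    by field; rewrite gt_eqF.
  apply: ler_wpM2r; first by rewrite divr_ge0 ?mulr_ge0 ?ltW.
  rewrite ler_pdivrMr// -natr1; suff : 1 <= M%:R :> R by lra.
  by rewrite ler1n.
- split=> x.
    apply: contra_notP => /eqP /spikes_neq0[m mM /ax axm].
    by rewrite /B -(bigcup_mkord _ (fun m => `[a m, a m + 2 * sigma]%classic)); exists m.
  move=> xK; apply/eqP; apply: contraT => /spikes_neq0[m mM /ax].
  have mjM : (m * j)%:R <= (M * j)%:R :> R by rewrite ler_nat leq_mul2r mM orbT.
  have : (m * j)%:R * sigma <= 2 * L by rewrite -sM mulrC ler_pM2l.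
  have : 0 <= (m * j)%:R * sigma by rewrite mulr_ge0 ?ler0n ?(ltW s0).
  rewrite /a => H1 H2 /andP[H3 H4].
  suff : `|x| < K + 4 by rewrite ltNge xK.
  by rewrite ltr_norml; apply/andP; rewrite /L in H1 H2 H3 H4 *; split; lra.
move=> x xK; rewrite /convolution /Rintegral.
set F := (\int[mu]_y (phi y * u (x - y))%:E)%E.
have mur c : measurable_fun [set: R] (fun y => u (c - y)).
  by apply: measurableT_comp => //; exact: measurable_funB.
have mc c : measurable_fun [set: R] (fun y => (phi y * u (c - y))%:E).
  by apply/measurable_EFinP; apply: measurable_funM => //; exact: mur.
have c0 c y : (0 <= (phi y * u (c - y))%:E)%E.
  by rewrite lee_fin mulr_ge0//; case/andP : (u01 (c - y)).
have F1 : (F <= 1)%E.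
  rewrite -phi1; apply: ge0_le_integral => //.
  - exact: mc.
  - exact/measurable_EFinP.
  - by move=> y _; rewrite lee_fin ler_piMr//; case/andP : (u01 (x - y)).
have F0 : (0 <= F)%E by exact: integral_ge0.
have Ffin : F \is a fin_num by rewrite ge0_fin_numE// (le_lt_trans F1)// ltry.
have [f Ff] : exists f, F = f%:E by exists (fine F); rewrite fineK.
rewrite Ff /=.
(* The [j] translates of the comb by multiples of [sigma] cover [[-K-1, K+1]], so their
   convolutions sum to at least 1/2 there, and these differ by at most [e]. *)
have shift i : (i < j)%N ->
    (\int[mu]_y (phi y * u (x - i%:R * sigma - y))%:E <= (f + e)%:E)%E.
  move=> ij; rewrite EFinD -Ff; apply: conv_translation_le => //; first exact: ltW.
  have is0 : 0 <= i%:R * sigma by apply: mulr_ge0; [exact: ler0n|exact: ltW].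
  apply: dphi; rewrite /ball/= sub0r normrN ger0_norm//.
  by apply: le_lt_trans sjd; rewrite ler_pM2r// ler_nat ltnW.
have sum : ((2^-1)%:E <= \sum_(i < j) (f + e)%:E)%E.
  apply: (@le_trans _ _ (\sum_(i < j)
      \int[mu]_y (phi y * u (x - i%:R * sigma - y))%:E)%E); last first.
    by apply: lee_sum => i _; exact: shift.
  rewrite -ge0_integral_sum//; last first.
    by move=> i; exact: mc.
  rewrite -[leLHS]mule1 -phi1 -ge0_integralZl//; last 2 first.
  - exact/measurable_EFinP.
  - by move=> y _; rewrite lee_fin.
  apply: ge0_le_integral => //.
  - by move=> y _; rewrite -EFinM lee_fin mulr_ge0.
  - by apply/measurable_EFinP; exact: measurable_funM.
  - by apply: emeasurable_sum => i; exact: mc.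
  move=> y _; rewrite -EFinM sumEFin lee_fin.
  have [y1|y1] := ltP 1 `|y|.
    by rewrite phisupp// mulr0 sumr_ge0// => i _; rewrite mul0r.
  have [i ij ui] : exists2 i, (i < j)%N & 2^-1 <= u (x - y - i%:R * sigma).
    move: xK y1; rewrite !ler_norml => /andP[? ?] /andP[? ?].
    by apply: spikes_cover => //; rewrite ?sM /L; lra.
  rewrite (bigD1 (Ordinal ij))//= mulrC; apply: ler_wpDr.
    by apply: sumr_ge0 => k _; rewrite mulr_ge0//; case/andP : (u01 (x - k%:R * sigma - y)).
  by rewrite ler_wpM2l// addrAC.
move: sum; rewrite sumEFin lee_fin sumr_const card_ord.
rewrite -[(f + e) *+ j]mulr_natr => H.
have ej : e * j%:R = 4^-1 by rewrite /e; field; rewrite gt_eqF.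
rewrite -(ler_pM2r jR); rewrite -/e ej.
by move: H; rewrite mulrDl ej; lra.
Qed.

End oscillation.

(** * Elements of Lp spaces *)

Section Lspace_elements.
Context d (T : measurableType d) (R : realType).
Variables (mu : {measure set T -> \bar R}) (p : \bar R).
Implicit Types f g : T -> R.

Lemma ae_le_Lnorm f g : (1 <= p)%E ->
  measurable_fun [set: T] f -> measurable_fun [set: T] g ->
  (\forall x \ae mu, `|f x| <= `|g x|) ->
  ('N[mu]_p[EFin \o f] <= 'N[mu]_p[EFin \o g])%E.
Proof.
case: p => [r||//] p1 mf mg fg; rewrite unlock /Lnorm; last first.
  by case: ifPn => // _; apply: le_ess_sup; apply: filterS fg => x /=; rewrite lee_fin.
have r0 : 0 < r by rewrite -lte_fin (lt_le_trans _ p1).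
have mr (h : T -> R) : measurable_fun [set: T] h ->
    measurable_fun [set: T] (fun x => `|(h x)%:E| `^ r)%E.
  move=> mh; apply: (@measurableT_comp _ _ _ _ _ _ (fun x => x `^ r)%E) => //.
    exact: measurable_poweR.
  by apply: measurableT_comp => //; exact/measurable_EFinP.
apply: gt0_ler_poweR; rewrite ?invr_ge0 ?(ltW r0)//.
- by rewrite in_itv/= leey andbT integral_ge0// => x _; exact: poweR_ge0.
- by rewrite in_itv/= leey andbT integral_ge0// => x _; exact: poweR_ge0.
apply: ae_ge0_le_integral => //.
- by move=> x _; exact: poweR_ge0.
- exact: mr.
- by move=> x _; exact: poweR_ge0.
- exact: mr.
apply: filterS fg => x fgx _.
by apply: gt0_ler_poweR; rewrite ?in_itv/= ?leey ?andbT ?lee_fin ?(ltW r0).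
Qed.

Lemma ae_eq_Lnorm f g : (1 <= p)%E ->
  measurable_fun [set: T] f -> measurable_fun [set: T] g ->
  (\forall x \ae mu, f x = g x) ->
  ('N[mu]_p[EFin \o f] = 'N[mu]_p[EFin \o g])%E.
Proof.
move=> p1 mf mg fg; apply/le_anti/andP; split; apply: ae_le_Lnorm => //;
  by apply: filterS fg => x ->.
Qed.

Lemma measurable_Lspace (p1 : (1 <= p)%E) (F : LspaceType mu p1) :
  measurable_fun [set: T] (F : T -> R).
Proof. exact: (@measurable_funPT _ _ _ _ (repr (LebesgueSpace.sort F))). Qed.

Lemma Lspace_of_fun (p1 : (1 <= p)%E) f : measurable_fun [set: T] f ->
  finite_norm mu p f ->
  exists F : LspaceType mu p1, \forall x \ae mu, (F : T -> R) x = f x.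
Proof.
move=> mf ff.
have {}mf : measurable_fun [set: T] (f : T -> measurableTypeR R) by [].
pose fm : {mfun T >-> measurableTypeR R} :=
  HB.pack f (isMeasurableFun.Build _ _ _ _ _ mf).
pose q : {mfun_ mu, T >-> measurableTypeR R} := \pi%qT fm.
have qf : \forall x \ae mu, repr q x = f x.
  have : repr q == fm %[mod {mfun_ mu, T >-> measurableTypeR R}]%qT by rewrite reprK.
  rewrite eqmodE => /asboolP; apply: filterS => x /(_ I).
  by [].
have fq : finite_norm mu p (q : T -> R).
  rewrite /finite_norm (ae_eq_Lnorm (q : T -> R) f)//.
  exact: (@measurable_funPT _ _ _ _ (repr q)).
pose F : LspaceType mu p1 := HB.pack q (isFinLebesgue.Build _ _ _ _ _ p1 _ fq).
by exists F.
Qed.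

End Lspace_elements.
Arguments ae_le_Lnorm {d T R mu p f g}.
Arguments ae_eq_Lnorm {d T R mu p f g}.
Arguments measurable_Lspace {d T R mu p p1} F.
Arguments Lspace_of_fun {d T R mu p} p1 {f}.

(** * From classes modulo null sets to functions *)

Section kernels.
Context {R : realType}.
Local Notation mu := (@lebesgue_measure R).
Implicit Types (k f g v : R -> R).

(** Equality holds at every [x], since [y |-> x - y] preserves null sets. *)
Lemma ae_eq_convolution k1 k2 f1 f2 x :
  measurable_fun [set: R] k1 -> measurable_fun [set: R] k2 ->
  measurable_fun [set: R] f1 -> measurable_fun [set: R] f2 ->
  (\forall y \ae mu, k1 y = k2 y) -> (\forall y \ae mu, f1 y = f2 y) ->
  convolution k1 f1 x = convolution k2 f2 x.
Proof.
move=> mk1 mk2 mf1 mf2 k12 f12.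
have mr f : measurable_fun [set: R] f ->
    measurable_fun [set: R] (fun y => f (x - y)).
  by move=> mf; apply: measurableT_comp => //; exact: measurable_funB.
rewrite /convolution /Rintegral; congr fine; apply: ae_eq_integral => //.
- by apply/measurable_EFinP; apply: measurable_funM => //; exact: mr.
- by apply/measurable_EFinP; apply: measurable_funM => //; exact: mr.
by move: k12 (ae_reflection x _ f12); apply: filterS2 => y -> ->.
Qed.

(** Taking the positive part and cutting to [[-1, 1]] changes [g] on a null set only. *)
Lemma unit_kernel_of_ae g : measurable_fun [set: R] g ->
  (\int[mu]_y `|(g y)%:E| = 1)%E -> (\forall y \ae mu, 0 <= g y) ->
  (\forall y \ae mu, y \notin `[-1, 1] -> g y = 0) ->
  exists2 k, unit_kernel k & \forall y \ae mu, k y = g y.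
Proof.
move=> mg g1 g0 gsupp.
pose k y := maxr 0 (g y) * \1_`[(-1)%R, 1%R : R]%classic y.
have mk : measurable_fun [set: R] k.
  apply: measurable_funM; first exact: measurable_maxr.
  by apply: measurable_indic; exact: measurable_itv.
have k0 y : 0 <= k y by rewrite mulr_ge0// le_max lexx.
have kg : \forall y \ae mu, k y = g y.
  move: g0 gsupp; apply: filterS2 => y gy0 gy.
  rewrite /k indicE (max_idPr gy0).
  case: (boolP (y \in _)) => [_|]; first by rewrite mulr1.
  by rewrite mulr0 notin_setE/= => /negP/gy.
have k1 : (\int[mu]_y (k y)%:E = 1)%E.
  rewrite -g1; apply: ge0_ae_eq_integral => //.
  - exact/measurable_EFinP.
  - by do 2 apply: measurableT_comp => //.
  - by move=> y _; rewrite lee_fin.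
  - move: kg g0; apply: filterS2 => y -> gy0 _.
    by rewrite /= ger0_norm.
exists k => //; split => //.
- apply/integrableP; split; first exact/measurable_EFinP.
  under eq_integral do rewrite gee0_abs ?lee_fin//=.
  by rewrite k1 ltry.
- move=> y y1; rewrite /k indicE memNset ?mulr0//= in_itv/= -ler_norml.
  by apply/negP; rewrite -ltNge.
Qed.

(** Transfers the defining limit, which speaks of classes, to an integrable function [v] through its
    class. *)
Lemma approximate_identity_near (phi : nat -> LspaceType1 mu) v (e : R) :
  approximate_identity phi -> measurable_fun [set: R] v ->
  mu.-integrable setT (EFin \o v) -> 0 < e ->
  \forall n \near \oo,
    (\int[mu]_x `|(convolution (phi n) v x - v x)%:E| < e%:E)%E.
Proof.
move=> aphi mv iv e0.
have fv : finite_norm mu 1 v.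
  by rewrite /finite_norm Lnorm1; case/integrableP : iv.
have [V Vv] : exists V : LspaceType1 mu, \forall x \ae mu, (V : R -> R) x = v x.
  exact: Lspace_of_fun.
have mphi n := measurable_Lspace (phi n).
have mV := measurable_Lspace V.
have iphi n : mu.-integrable setT (EFin \o (phi n : R -> R)).
  apply/integrableP; split; first exact/measurable_EFinP.
  by have := Lebesgue_finite (s := phi n); rewrite /finite_norm Lnorm1.
have iV : mu.-integrable setT (EFin \o (V : R -> R)).
  apply/integrableP; split; first exact/measurable_EFinP.
  by have := Lebesgue_finite (s := V); rewrite /finite_norm Lnorm1.
have near_lt : \forall n \near \oo,
    ('N[mu]_1[EFin \o (convolution (phi n) V \- V)%R] < e%:E)%E.
  exact: (aphi V _ (@open_ereal_lt' _ 0%E e%:E e0)).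
apply: filterS near_lt => n /=.
rewrite Lnorm1; apply: le_lt_trans.
rewrite le_eqVlt; apply/orP; left; apply/eqP.
have mc f : measurable_fun [set: R] f -> mu.-integrable setT (EFin \o f) ->
    measurable_fun [set: R] (fun x => `|(convolution (phi n) f x - f x)%:E|%E).
  move=> mf jf; apply: measurableT_comp => //; apply/measurable_EFinP.
  apply: measurable_funB => //.
  exact: (measurable_convolution _ _ (mphi n) mf (iphi n) jf).
apply: ge0_ae_eq_integral => //.
- exact: mc.
- exact: mc.
apply: filterS (Vv) => x Vx _ /=; rewrite Vx.
by rewrite (ae_eq_convolution _ (phi n) v V)//;
  [exact: mphi|exact: mphi|exact: aeW|apply: filterS Vv => y ->].
Qed.

End kernels.

(** * Perturbations *)

Section perturbation.
Context {R : realType}.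
Local Notation mu := (@lebesgue_measure R).
Implicit Types (k f g v u h : R -> R) (L s r : R).

(** The regularity shared by CB and all Lp on which the construction of perturbations rests. *)
Definition locally_integrable_fun f := measurable_fun [set: R] f /\
  forall L, mu.-integrable `[- L, L] (EFin \o f).

(** Truncation brings a locally integrable function into L1, where the approximate identity and
    Young's inequality apply. *)
Definition cut L f : R -> R := f \_ `[- L, L].

Lemma cut_in L f x : `|x| <= L -> cut L f x = f x.
Proof.
by move=> xL; rewrite /cut patchE mem_set//= in_itv/= -ler_norml.
Qed.

Lemma integral_cut L f :
  (\int[mu]_x `|(cut L f x)%:E| = \int[mu]_(x in `[(- L)%R, L]) `|(f x)%:E|)%E.
Proof.
rewrite [RHS]integral_mkcond; apply: eq_integral => x _.
rewrite /cut !patchE; case: ifPn => // _.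
by rewrite [X in X = _](_ : _ = `|0%:E|%E)// abse0.
Qed.

Lemma measurable_cut L f : measurable_fun [set: R] f ->
  measurable_fun [set: R] (cut L f).
Proof.
move=> mf; rewrite (_ : cut L f = fun x => f x * \1_(`[- L, L]%classic) x).
  apply: measurable_funM => //; apply: measurable_indic; exact: measurable_itv.
apply/funext => x; rewrite /cut patchE indicE.
by case: ifPn; rewrite ?mulr1 ?mulr0.
Qed.

Lemma integrable_cut L f : locally_integrable_fun f ->
  mu.-integrable setT (EFin \o cut L f).
Proof.
move=> [mf jf]; apply/integrableP; split.
  by apply/measurable_EFinP; exact: measurable_cut.
by have /integrableP[_] := jf L; rewrite -integral_cut.
Qed.

Lemma locally_integrable_continuous f : continuous f -> locally_integrable_fun f.
Proof.
move=> cf; split; first exact: continuous_measurable_fun.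
move=> L; apply: continuous_compact_integrable; first exact: segment_compact.
exact: continuous_subspaceT.
Qed.

Lemma integrable_conv k v x : measurable_fun [set: R] k ->
  measurable_fun [set: R] v ->
  (\int[mu]_y `|(k y * v (x - y))%:E| < +oo)%E ->
  mu.-integrable setT (EFin \o (fun y => k y * v (x - y))).
Proof.
move=> mk mv kv; apply/integrableP; split => //.
apply/measurable_EFinP; apply: measurable_funM => //.
by apply: measurableT_comp => //; exact: measurable_funB.
Qed.

Lemma le_norm_convolution k v x (e : R) : measurable_fun [set: R] k ->
  measurable_fun [set: R] v ->
  (\int[mu]_y `|(k y * v (x - y))%:E| < e%:E)%E ->
  `|convolution k v x| <= e.
Proof.
move=> mk mv kv; have kvoo := lt_trans kv (ltry e).
have ikv := integrable_conv k v x mk mv kvoo.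
apply: le_trans (le_normr_Rintegral measurableT ikv) _.
rewrite /Rintegral -lee_fin fineK; first exact: ltW.
by rewrite ge0_fin_numE// integral_ge0.
Qed.

Lemma unit_kernel_bounded_conv k u x : unit_kernel k ->
  measurable_fun [set: R] u -> (forall x, 0 <= u x <= 1) ->
  mu.-integrable setT (EFin \o (fun y => k y * u (x - y))).
Proof.
move=> [mk ik k0 _ k1] mu_ u01; apply: integrable_conv => //.
apply: (@le_lt_trans _ _ 1%E); last exact: ltry.
rewrite -k1; apply: ge0_le_integral => //.
- do 2 apply: measurableT_comp => //; apply: measurable_funM => //.
  by apply: measurableT_comp => //; exact: measurable_funB.
- exact/measurable_EFinP.
- move=> y _; have /andP[? ?] := u01 (x - y).
  by rewrite lee_fin ger0_norm ?mulr_ge0// ler_piMr.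
Qed.

(* The kernel lives on [-1, 1], so near [x] it only sees [g] through [cut L g]. *)
Lemma convolution_decomposition k f g u L x (c : R) : unit_kernel k ->
  measurable_fun [set: R] f -> measurable_fun [set: R] g ->
  measurable_fun [set: R] u -> (forall x, 0 <= u x <= 1) ->
  `|x| + 1 <= L ->
  (\int[mu]_y `|(k y * cut L f (x - y))%:E| < +oo)%E ->
  (\int[mu]_y `|(k y * cut L (g \- (f \+ (c \*o u))) (x - y))%:E| < +oo)%E ->
  convolution k g x = convolution k (cut L f) x + c * convolution k u x +
    convolution k (cut L (g \- (f \+ (c \*o u)))) x.
Proof.
move=> kk mf mg mu_ u01 xL fL gL; have [mk ik k0 ksupp k1] := kk.
have mcf := measurable_cut L f mf.
have mcg : measurable_fun [set: R] (cut L (g \- (f \+ (c \*o u)))).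
  apply: measurable_cut; apply: measurable_funB => //.
  by apply: measurable_funD => //; exact: measurable_funM.
have i1 := integrable_conv _ _ x mk mcf fL.
have i2 := unit_kernel_bounded_conv k u x kk mu_ u01.
have i3 := integrable_conv _ _ x mk mcg gL.
have i2' : mu.-integrable setT (EFin \o (fun y => c * (k y * u (x - y)))).
  by apply: eq_integrable (integrableZl _ c i2) => // y _; rewrite /= EFinM.
rewrite /convolution -RintegralZl// -RintegralD// -RintegralD//; last first.
  by apply: eq_integrable (integrableD _ i1 i2') => // y _; rewrite /= EFinD.
apply: eq_Rintegral => y _.
have [y1|y1] := ltP 1 `|y|; first by rewrite ksupp// !mul0r mulr0 !addr0.
have xyL : `|x - y| <= L by have := ler_normB x y; lra.
by rewrite !cut_in//=; ring.
Qed.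

End perturbation.

(** * A small perturbation that forces oscillation at a given scale *)

Section key_perturbation.
Context {R : realType}.
Local Notation mu := (@lebesgue_measure R).
Variables (phi : nat -> LspaceType1 mu) (eps : nat -> R).
Hypothesis phi_proper : proper_approximate_identity phi.
Hypothesis eps_cvg0 : eps n @[n --> \oo] --> 0.
Implicit Types (f g h u : R -> R) (s r : R) (k : nat).

(** The sign [s], 1 or -1, treats upper and lower limits together. A single [k] governs index,
    window, height and exceptional set, so that countably many conditions suffice. *)
Definition oscillates_at s k g := exists n B, [/\ (k <= n)%N, measurable B,
  (mu B <= (2 ^- k)%:E)%E &
  forall x, `|x| <= k%:R -> ~ B x ->
    k%:R * eps n <= s * (convolution (phi n) g x - g x)].

Definition weight (x : R) : R := (oneDsqr x)^-1.

Lemma lebesgue_measureU_le (A B : set R) (a b : \bar R) :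
  measurable A -> measurable B -> (mu A <= a)%E -> (mu B <= b)%E ->
  (mu (A `|` B) <= a + b)%E.
Proof.
move=> mA mB Aa Bb; apply: le_trans (leeD Aa Bb).
exact: (measureU2 mu).
Qed.

Lemma near_unit_kernel : \forall n \near \oo, exists2 kn : R -> R,
  unit_kernel kn & \forall y \ae mu, kn y = (phi n : R -> R) y.
Proof.
have [_ phi1 [_ /(_ 1 ltr01)[N phisupp]] phi0] := phi_proper.
exists N => // n Nn; apply: unit_kernel_of_ae.
- exact: (measurable_Lspace (phi n)).
- by have := phi1 n; rewrite Lnorm1.
- exact: phi0.
- exact: phisupp.
Qed.

(** The comb contributes at least [q]. Three errors below [q / 4] each, from [f], from the convolved
    deviation of [g] and from that deviation itself, leave at least [q / 4], which exceeds
    [k * eps n]. The condition on [g] is a local L1 ball, hence open in every space considered. *)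
Lemma exists_perturbation s k f r : `|s| = 1 -> locally_integrable_fun f ->
  0 < r -> exists h, [/\ continuous h, forall x, `|h x| <= r &
    exists L rho : R, 0 < rho /\ forall g, locally_integrable_fun g ->
      (\int[mu]_(x in `[(- L)%R, L]) `|(g x - (f x + weight x * h x))%:E| < rho%:E)%E ->
      oscillates_at s k g].
Proof.
move=> s1 lf r0.
pose K : R := k%:R; pose L := K + 1; pose a : R := 2 ^- k.
have K0 : 0 <= K by exact: ler0n.
have a0 : 0 < a by rewrite invr_gt0 exprn_gt0.
(* Makes the measure of the spikes at most [a / 5]; three more sets of that size and a null set fit
   into the allowance [a]. *)
pose j := (truncn (8 * (K + 2) * 5 / a)).+1.
have jR : 0 < j%:R :> R by rewrite ltr0n.
have ja : 8 * (K + 2) / j%:R <= a / 5.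
  rewrite ler_pdivrMr// mulrAC ler_pdivlMr// -ler_pdivrMl// mulrC.
  exact/ltW/truncnS_gt.
have K4 : 0 < 1 + (K + 4) ^+ 2 by rewrite ltr_pwDl// sqr_ge0.
(* The comb vanishes for [|x| >= K + 4], so dividing by the weight costs a factor of at most
   [1 + (K + 4) ^+ 2]. *)
pose r' := r / (1 + (K + 4) ^+ 2).
have r'0 : 0 < r' by rewrite divr_gt0.
pose q := r' * (4 * j%:R)^-1.
have q0 : 0 < q by rewrite mulr_gt0// invr_gt0 mulr_gt0.
have q40 : 0 < q / 4 by rewrite divr_gt0.
(* Chebyshev's inequality at level [q / 4] then gives exceptional sets of measure at most
   [a / 5]. *)
pose rho := q / 4 * (a / 5).
have rho0 : 0 < rho by rewrite mulr_gt0// divr_gt0.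
have [mf jf] := lf.
have mv0 := measurable_cut L f mf.
have iv0 := integrable_cut L f lf.
have [aphi _ _ _] := phi_proper.
have near1 := approximate_identity_near phi _ _ aphi mv0 iv0 rho0.
have near2 : \forall n \near \oo, K * eps n < q / 4.
  apply: (@cvgr_lt _ _ _ _ (fun n => K * eps n) 0 _ _ q40).
  by rewrite -(mulr0 K); apply: cvgM => //; exact: cvg_cst.
(* The index is fixed before the comb: [q] depends on [j] only, whereas the period of the comb
   depends on the kernel. *)
have [n [kn n1 n2 [ker kerker kerphi]]] : exists n, [/\ (k <= n)%N,
    (\int[mu]_x `|(convolution (phi n) (cut L f) x - cut L f x)%:E| < rho%:E)%E,
    K * eps n < q / 4 &
    exists2 kn : R -> R, unit_kernel kn & \forall y \ae mu, kn y = (phi n : R -> R) y].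
  have near_all := filterI (filterI (nbhs_infty_ge k) near1) (filterI near2 near_unit_kernel).
  have [N _ /(_ N (leqnn N)) [[? ?] [? ?]]] := near_all.
  by exists N; split.
have [u [Bu [cu u01 [mBu Bu_le] [uBu uK] uconv]]] :=
  unit_kernel_oscillation ker K j kerker K0 isT.
have mker : measurable_fun [set: R] ker by case: kerker.
have iker : mu.-integrable setT (EFin \o ker) by case: kerker.
have ker1 : (\int[mu]_y `|(ker y)%:E| <= 1)%E.
  have [_ _ k0 _ <-] := kerker; rewrite le_eqVlt; apply/orP; left; apply/eqP.
  by apply: eq_integral => y _; rewrite gee0_abs// lee_fin.
have mu_ : measurable_fun [set: R] u by exact: continuous_measurable_fun.
have kconv g x : measurable_fun [set: R] g ->
    convolution (phi n) g x = convolution ker g x.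
  move=> mg; apply: ae_eq_convolution => //; last exact: aeW.
    exact: (measurable_Lspace (phi n)).
  by apply: filterS kerphi => y ->.
have ss : s * s = 1 by rewrite -expr2 -real_normK ?num_real// s1 expr1n.
have od0 x : 0 < oneDsqr x :> R by apply: lt_le_trans ltr01 _; exact: oneDsqr_ge1.
pose h x := s * r' * u x * oneDsqr x.
have wh x : weight x * h x = s * r' * u x.
  by rewrite /weight /h mulrCA mulVf ?mulr1// gt_eqF.
exists h; split.
- move=> x; apply: cvgM; last exact: continuous_oneDsqr.
  by apply: cvgM; [exact: cvg_cst|exact: cu].
- move=> x; rewrite /h 3!normrM s1 mul1r (gtr0_norm r'0).
  have [xK|xK] := leP (K + 4) `|x|; first by rewrite uK// normr0 mulr0 mul0r ltW.
  have /andP[u0 u1] := u01 x; rewrite (ger0_norm u0) (gtr0_norm (od0 x)).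
  have x2 : oneDsqr x <= 1 + (K + 4) ^+ 2.
    rewrite /oneDsqr lerD2l -real_normK ?num_real// ler_pXn2r// ?nnegrE ?addr_ge0//.
    exact: ltW.
  rewrite -mulrA; apply: (@le_trans _ _ (r' * (1 * (1 + (K + 4) ^+ 2)))).
    by rewrite ler_wpM2l ?(ltW r'0)// ler_pM// ltW.
  by rewrite mul1r /r' divfK// gt_eqF.
exists L, rho; split => // g lg; rewrite -(integral_cut L (fun x => g x - (f x + weight x * h x))).
have [mg jg] := lg.
rewrite (_ : (fun x => _) = (g \- (f \+ ((s * r') \*o u)))); last first.
  by apply/funext => x; rewrite wh.
set v1 := cut L _ => v1rho.
have mv1 : measurable_fun [set: R] v1.
  apply: measurable_cut; apply: measurable_funB => //.
  by apply: measurable_funD => //; exact: measurable_funM.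
pose w0 x := convolution (phi n) (cut L f) x - cut L f x.
have mw0 : measurable_fun [set: R] w0.
  apply: measurable_funB => //.
  rewrite (_ : convolution _ _ = convolution ker (cut L f)).
    exact: measurable_convolution.
  by apply/funext => x; exact: kconv.
(* Off the null set [N0] the convolution with the truncated [f] converges absolutely, which
   linearity of the integral requires. *)
have [N0 [mN0 muN0 N0sub]] : \forall x \ae mu,
    (\int[mu]_y `|(ker y * cut L f (x - y))%:E| < +oo)%E.
  have : mu.-integrable setT (fun x => \int[mu]_y `|(ker y * cut L f (x - y))%:E|)%E.
    apply/integrableP; split; first exact: measurable_conv_abs.
    under eq_integral do rewrite gee0_abs ?integral_ge0//.
    rewrite integral_conv_abs// lte_mul_pinfty//.
    - exact: integral_ge0.
    - by rewrite ge0_fin_numE ?integral_ge0//; case/integrableP : iker.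
    - by case/integrableP : iv0.
  move/(integrable_ae measurableT); apply: filterS => x /(_ I).
  by rewrite ge0_fin_numE// integral_ge0.
pose B1 := [set x | q / 4 <= `|w0 x|].
pose B3 := [set x | ((q / 4)%:E <= \int[mu]_y `|(ker y * v1 (x - y))%:E|)%E].
pose B4 := [set x | q / 4 <= `|v1 x|].
have a5E : a / 5 = (q / 4)^-1 * rho by rewrite /rho mulKf// gt_eqF.
have B1_le : (mu B1 <= (a / 5)%:E)%E.
  apply: le_trans (le_measure_norm _ _ q40 mw0) _.
  rewrite a5E EFinM lee_wpmul2l ?lee_fin ?invr_ge0 ?(ltW q40)//.
  exact: ltW.
have B3_le : (mu B3 <= (a / 5)%:E)%E.
  apply: le_trans (le_measure_conv_abs _ _ _ q40 mker mv1 ker1) _.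
  rewrite a5E EFinM lee_wpmul2l ?lee_fin ?invr_ge0 ?(ltW q40)//.
  exact: ltW.
have B4_le : (mu B4 <= (a / 5)%:E)%E.
  apply: le_trans (le_measure_norm _ _ q40 mv1) _.
  rewrite a5E EFinM lee_wpmul2l ?lee_fin ?invr_ge0 ?(ltW q40)//.
  exact: ltW.
have m_ge_norm (v : R -> R) : measurable_fun [set: R] v -> measurable [set x | q / 4 <= `|v x|].
  move=> mv; rewrite -[X in measurable X]setTI.
  by apply: measurable_fun_le => //; exact: measurableT_comp.
have mB1 : measurable B1 by exact: m_ge_norm.
have mB4 : measurable B4 by exact: m_ge_norm.
have mB3 : measurable B3.
  rewrite -[X in measurable X]setTI; apply: measurable_lee => //.
  exact: measurable_conv_abs.
exists n, (Bu `|` (N0 `|` (B1 `|` (B3 `|` B4)))); split => //.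
- by do !apply: measurableU.
- apply: (@le_trans _ _ ((a / 5)%:E + (0 + ((a / 5)%:E + ((a / 5)%:E + (a / 5)%:E))))%E).
    apply: lebesgue_measureU_le => //; [by do !apply: measurableU| |].
      by apply: le_trans Bu_le _; rewrite lee_fin.
    apply: lebesgue_measureU_le => //; [by do !apply: measurableU| |].
      by rewrite le_eqVlt; apply/orP; left; exact/eqP.
    apply: lebesgue_measureU_le => //; first exact: measurableU.
    exact: lebesgue_measureU_le.
  by rewrite add0e -!EFinD lee_fin -/a; lra.
move=> x xk nB.
have [nBu nN0 nB1 nB3 nB4] : [/\ ~ Bu x, ~ N0 x, ~ B1 x, ~ B3 x & ~ B4 x].
  by split => Hx; apply: nB; [left|right; left|right; right; left
    |right; right; right; left|right; right; right; right].
have xL : `|x| <= L by rewrite /L; lra.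
have {nN0} fin0 : (\int[mu]_y `|(ker y * cut L f (x - y))%:E| < +oo)%E.
  by apply: contrapT => H; apply: nN0; apply: N0sub.
have {nB3} small3 : (\int[mu]_y `|(ker y * v1 (x - y))%:E| < (q / 4)%:E)%E.
  by rewrite ltNge; apply/negP.
have conv3 := le_norm_convolution _ _ _ _ mker mv1 small3.
have {nB1} w01 : `|w0 x| < q / 4 by rewrite ltNge; apply/negP.
have {nB4} v14 : `|v1 x| < q / 4 by rewrite ltNge; apply/negP.
have xL1 : `|x| + 1 <= L by rewrite lerD2r.
rewrite kconv// (convolution_decomposition ker f g u L x (s * r') kerker)//; last first.
  exact: lt_trans small3 (ltry _).
rewrite -/v1.
(* Off [Bu] the comb vanishes, so it enters the convolution but not the value of [g] at [x]. *)
have gx : g x = f x + v1 x.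
  by rewrite /v1 cut_in//= uBu//; ring.
move: w01; rewrite /w0 kconv// cut_in// gx => w01.
have ucx := uconv x xk.
have qu : q <= r' * convolution ker u x by rewrite ler_pM2l.
have E : s * (convolution ker (cut L f) x + s * r' * convolution ker u x +
   convolution ker v1 x - (f x + v1 x)) =
   s * (convolution ker (cut L f) x - f x) + s * s * (r' * convolution ker u x) +
   s * convolution ker v1 x - s * v1 x by ring.
rewrite E ss mul1r.
have snorm y : `|s * y| = `|y| by rewrite normrM s1 mul1r.
move: w01 conv3 v14; rewrite -(snorm (_ - f x)) -(snorm (v1 x)) -(snorm (convolution _ v1 x)).
rewrite !ltr_norml ler_norml => /andP[? ?] /andP[? ?] /andP[? ?].
lra.
Qed.

End key_perturbation.

(** * Baire's theorem *)

Section baire.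
Context {R : realType}.

(** The classical argument with nested closed balls of radius at least halved at each step.
    Completeness is assumed for sequences with an explicit rate, which here is the radius. *)
Lemma baire_metric (M : metricType R) :
  (forall (u : nat -> M) (r : nat -> R),
    (forall n m, (n <= m)%N -> mdist (u n) (u m) <= r n) ->
    r n @[n --> \oo] --> 0 -> exists l, forall n, mdist (u n) l <= r n) ->
  forall F : (set M)^nat, (forall i, open (F i)) -> (forall i, dense (F i)) ->
  dense (\bigcap_i F i).
Proof.
move=> complete F oF dF O [x0 Ox0] oO.
(* Pairs are centre and radius. Halving the radius and moving the centre by at most half of it keeps
   the new closed ball inside the old one; for a nonpositive radius the condition is vacuous, so
   [next] is total. *)
pose P n (a b : M * R) := 0 < a.2 -> [/\ 0 < b.2, b.2 <= a.2 / 2,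
  mdist a.1 b.1 <= a.2 / 2 & forall y, mdist b.1 y <= b.2 -> F n y].
have /choice[next nextP] : forall na : nat * (M * R), exists b, P na.1 na.2 b.
  move=> [n [a r]]; have [r0|r0] := ltP 0 r; last by exists (a, r); rewrite /P/= ltNge r0.
  have r20 : 0 < r / 2 by rewrite divr_gt0.
  have [b [] /=] : (ball a (r / 2))° `&` F n !=set0.
    apply: dF; last exact: open_interior.
    by exists a; exact: nbhsx_ballx.
  move=> /interior_subset; rewrite ballEmdist/= => ab Fnb.
  have /nbhs_ballP[d /= d0 bd] := open_nbhs_nbhs (conj (oF n) Fnb).
  exists (b, minr (r / 2) (d / 2)) => _ /=; split.
  - by rewrite lt_min r20 divr_gt0.
  - by rewrite ge_min lexx.
  - exact: ltW.
  - move=> y by_; apply: bd; rewrite ballEmdist/=; apply: le_lt_trans by_ _.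
    by rewrite gt_min [d / 2 < d]ltr_pdivrMr// ltr_pMr// ltr1n orbT.
have /nbhs_ballP[d /= d0 Od] := open_nbhs_nbhs (conj oO Ox0).
pose ar := fix ar n := if n is m.+1 then next (m, ar m) else (x0, d / 2).
have ar0 n : 0 < (ar n).2.
  elim: n => [/=|n IH]; first by rewrite divr_gt0.
  by have [] := nextP (n, ar n) IH.
have arP n : P n (ar n) (ar n.+1) by exact: (nextP (n, ar n)).
have nested m k y : mdist (ar (m + k)%N).1 y <= (ar (m + k)%N).2 ->
    mdist (ar m).1 y <= (ar m).2.
  elim: k => [|k IH]; first by rewrite addn0.
  rewrite addnS => H; apply: IH.
  have [_ h1 h2 _] := arP (m + k)%N (ar0 _).
  apply: le_trans (metric_triangle _ (ar (m + k).+1).1 _) _.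
  by rewrite [leRHS]splitr lerD// (le_trans H).
have arcvg : (ar n).2 @[n --> \oo] --> 0.
  have le_geo n : (ar n).2 <= geometric (d / 2) 2^-1 n.
    elim: n => [|n IH] /=; first by rewrite expr0 mulr1.
    have [_ h1 _ _] := arP n (ar0 n); apply: le_trans h1 _.
    by rewrite exprSr mulrA ler_pM2r.
  apply: (@squeeze_cvgr _ _ _ _ (cst 0) (geometric (d / 2) 2^-1)).
  - by apply: nearW => n; rewrite ltW//=; exact: le_geo.
  - exact: cvg_cst.
  - by apply: cvg_geometric; rewrite ger0_norm// invf_lt1// ltr1n.
have [|//|l lP] := complete (fun n => (ar n).1) (fun n => (ar n).2).
  move=> n m nm; rewrite -(subnKC nm); apply: (nested n (m - n)%N).
  by rewrite mdistxx ltW.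
exists l; split.
  apply: Od; rewrite ballEmdist/=; apply: le_lt_trans (lP 0%N) _.
  by rewrite /= ltr_pdivrMr// ltr_pMr// ltr1n.
by move=> n _; have [_ _ _] := arP n (ar0 n); apply; exact: lP n.+1.
Qed.

Lemma CB_dist_ge (f g : CB R) x : `|f x - g x| <= CB_dist f g.
Proof.
apply: sup_upper_bound; last by exists x.
split; first by exists `|f 0 - g 0|; exists 0.
have [M [_ fM]] := CB_bounded f; have [N [_ gN]] := CB_bounded g.
exists (M + 1 + (N + 1)) => _ [y _ <-].
by rewrite (le_trans (ler_normB _ _))// lerD// ?fM ?gN// ltrDl.
Qed.

Lemma CB_dist_le (f g : CB R) (M : R) :
  (forall x, `|f x - g x| <= M) -> CB_dist f g <= M.
Proof.
move=> fgM; apply: ge_sup; first by exists `|f 0 - g 0|; exists 0.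
by move=> _ [x _ <-].
Qed.

(** The rate [r] passes to the pointwise limit, so convergence is uniform and the limit is
    continuous and bounded. *)
Lemma CB_complete (u : nat -> CB R) (r : nat -> R) :
  (forall n m, (n <= m)%N -> CB_dist (u n) (u m) <= r n) ->
  r n @[n --> \oo] --> 0 -> exists l, forall n, CB_dist (u n) l <= r n.
Proof.
move=> ur r0.
have ucvg x : cvgn (fun n => u n x).
  apply/cauchy_cvgP/cauchy_exP => e e0.
  have [N _ /(_ N (leqnn N)) rN] := cvgr_lt _ r0 e e0.
  exists (u N x), N => // m /= Nm; rewrite /ball/=.
  by apply: le_lt_trans rN; apply: le_trans (CB_dist_ge _ _ _) (ur _ _ Nm).
pose l x := limn (fun n => u n x).
have ul n x : `|u n x - l x| <= r n.
  have cv : `|u n x - u m x| @[m --> \oo] --> `|u n x - l x|.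
    by apply: cvg_norm; apply: cvgB; [exact: cvg_cst|exact: ucvg].
  rewrite -(cvg_lim _ cv)//; apply: limr_le; first by apply/cvg_ex; exists (`|u n x - l x|).
  exists n => // m /= nm.
  exact: le_trans (CB_dist_ge _ _ _) (ur _ _ nm).
have cl : continuous l.
  move=> x; apply/cvgrPdist_le => e e0.
  have e3 : 0 < e / 3 by rewrite divr_gt0.
  have [N _ /(_ N (leqnn N)) rN] := cvgr_lt _ r0 _ e3.
  have /cvgrPdist_lt/(_ _ e3)  := @CB_continuous _ (u N) x.
  apply: filterS => y uxy.
  rewrite (_ : l x - l y = - (u N x - l x) + (u N x - u N y) + (u N y - l y)); last by ring.
  rewrite (le_trans (ler_normD _ _))// (le_trans (lerD (ler_normD _ _) (lexx _)))//.
  rewrite normrN; have := ul N x; have := ul N y; rewrite /= in rN; lra.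
have bl : bounded_fun l.
  have [M [Mreal uM]] := CB_bounded (u 0%N).
  exists (M + 1 + r 0%N); split; first exact: num_real.
  move=> K MK x _ /=; rewrite (_ : l x = u 0%N x - (u 0%N x - l x)); last by ring.
  rewrite (le_trans (ler_normB _ _))// (le_trans _ (ltW MK))//.
  by rewrite lerD ?ul// uM// ltrDl.
by exists (MkCB cl bl) => n; apply: CB_dist_le => x; exact: ul.
Qed.

End baire.

(** * From all scales to almost every point, and the generic set *)

Section generic_space.
Context {R : realType}.
Local Notation mu := (@lebesgue_measure R).
Implicit Types (s : R) (k m n : nat).

Lemma limn_esup_pinfty (q : nat -> R) :
  (forall m, exists2 n, (m <= n)%N & m%:R <= q n) ->
  limn_esup (fun n => (q n)%:E) = +oo%E.
Proof.
move=> qm; rewrite limn_esup_lim (_ : esups _ = cst +oo%E).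
  by apply/cvg_lim => //; exact: cvg_cst.
apply/funext => n; apply/eqyP => a a0.
have [l nl al] := qm (maxn n (truncn a).+1).
apply: (@le_trans _ _ (q l)%:E).
  rewrite lee_fin (le_trans _ al)// (le_trans (ltW (truncnS_gt _)))//.
  by rewrite ler_nat leq_maxr.
by apply: ereal_sup_ubound; exists l => //=; apply: leq_trans nl; exact: leq_maxl.
Qed.

Variables (phi : nat -> LspaceType1 mu) (eps : nat -> R).
Hypothesis phi_proper : proper_approximate_identity phi.
Hypothesis eps_gt0 : forall n, 0 < eps n.
Hypothesis eps_cvg0 : eps n @[n --> \oo] --> 0.

(** The exceptional sets have measure at most [2 ^- k], so each tail intersection [C m] is null. A
    point outside all of them avoids [B k] for arbitrarily large [k]. *)
Lemma oscillates_at_ae s (g : R -> R) : (forall k, oscillates_at phi eps s k g) ->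
  \forall x \ae mu, forall m, exists2 n, (m <= n)%N &
    m%:R <= s * ((convolution (phi n) g x - g x) / eps n).
Proof.
move=> /choice[N /choice[B NB]].
pose C m := \bigcap_i B (m + i)%N.
have mB k : measurable (B k) by have [] := NB k.
have mC m : measurable (C m) by apply: bigcapT_measurable => i; exact: mB.
have C0 m : mu (C m) = 0.
  apply/eqP; rewrite -measure_le0; apply/lee_addgt0Pr => e e0; rewrite add0e.
  (* Then [2 ^ (m + i) >= 2 ^ i >= i + 1 > e^-1]. *)
  pose i := truncn e^-1.
  have [_ _ Bi _] := NB (m + i)%N.
  apply: (@le_trans _ _ (mu (B (m + i)%N))).
    by apply: le_measure; rewrite ?inE//; apply: bigcap_inf.
  apply: le_trans Bi _; rewrite lee_fin.
  rewrite -[leRHS]invrK lef_pV2 ?posrE ?invr_gt0 ?exprn_gt0//.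
  apply: le_trans (ltW (truncnS_gt _)) _; rewrite -natrX ler_nat.
  apply: (leq_trans (ltn_expl i (leqnn 2))).
  by rewrite leq_exp2l// leq_addl.
have : mu.-negligible (\bigcup_m C m).
  by apply: negligible_bigcup => m; exists (C m); split; [exact: mC|exact: C0|].
move=> [A [mA A0 CA]]; exists A; split => // x /= xA; apply: CA; apply: contrapT => xC.
apply: xA => m.
(* From [m'] on the scale exceeds [m] and the window contains [x]. *)
pose m' := maxn m (truncn `|x|).+1.
have [i xB] : exists i, ~ B (m' + i)%N x.
  by apply: contrapT => /forallNP H; apply: xC; exists m' => // i _; apply: contrapT; exact: H.
have [kn _ _ /(_ x)] := NB (m' + i)%N.
set k := (m' + i)%N in kn xB *; set n := N k in kn *.
have mk : (m <= k)%N by rewrite (leq_trans _ (leq_addr _ _))// leq_maxl.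
have xk : `|x| <= k%:R.
  rewrite (le_trans (ltW (truncnS_gt _)))// ler_nat.
  by rewrite (leq_trans _ (leq_addr _ _))// leq_maxr.
move=> /(_ xk xB) H; exists n; first exact: leq_trans kn.
rewrite mulrA ler_pdivlMr//; apply: le_trans H.
by rewrite ler_wpM2r ?(ltW (eps_gt0 _))// ler_nat.
Qed.

Lemma oscillates_at_ae_oscillates (g : R -> R) :
  (forall k, oscillates_at phi eps 1 k g) ->
  (forall k, oscillates_at phi eps (-1) k g) -> ae_oscillates phi eps g.
Proof.
move=> /oscillates_at_ae gp /oscillates_at_ae gn; split.
  apply: filterS gp => x H; apply: limn_esup_pinfty => m.
  by have [n mn] := H m; rewrite mul1r; exists n.
apply: filterS gn => x H; apply: oppe_inj; rewrite -limn_esupN.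
rewrite [_ \o _](_ : _ = fun n => (-1 * ((convolution (phi n) g x - g x) / eps n))%:E).
  exact: limn_esup_pinfty.
by apply/funext => n /=; rewrite mulN1r.
Qed.

(* [T F h] stands for [F + weight * h]; as CB is complete, Baire's theorem can be
   applied to the parameter [h], whether or not [X] is known to be complete. *)
Lemma generic_oscillation (X : topologicalType) (ev : X -> R -> R)
    (T : X -> CB R -> X) (h0 : CB R) :
  (forall F, locally_integrable_fun (ev F)) ->
  (forall F L e, 0 < e -> \forall G \near F,
    (\int[mu]_(x in `[(- L)%R, L]) `|(ev G x - ev F x)%:E| < e%:E)%E) ->
  (forall F h, \forall x \ae mu, ev (T F h) x = ev F x + weight x * h x) ->
  (forall F, continuous (T F)) -> (forall F, T F h0 = F) ->
  exists A : set X, [/\ Gdelta A, dense A &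
    forall F, A F -> ae_oscillates phi eps (ev F)].
Proof.
move=> loc near_ev Tev Tcont T0.
(* One sequence enumerates both signs and all scales: the parity of [i] is the sign, its half the
   scale. *)
pose S i : set X := [set F | oscillates_at phi eps ((-1) ^+ odd i) i./2 (ev F)].
exists (\bigcap_i (S i)°); split.
- by exists (fun i => (S i)°) => // i; exact: open_interior.
- move=> O [F OF] oO.
  have oT i : open (T F @^-1` (S i)°).
    by move/continuousP : (Tcont F); apply; exact: open_interior.
  have dT i : dense (T F @^-1` (S i)°).
    move=> W [h1 Wh1] oW.
    have /nbhs_ballP[d /= d0 dW] := open_nbhs_nbhs (conj oW Wh1).
    have d20 : 0 < d / 2 by rewrite divr_gt0.
    have s1 : `|(-1) ^+ odd i| = 1 :> R by rewrite normr_sign.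
    have [h [ch hd [L [rho [rho0 hS]]]]] :=
      exists_perturbation phi eps phi_proper eps_cvg0 _ i./2 _ _ s1 (loc (T F h1)) d20.
    have ch2 : continuous (fun x => h1 x + h x).
      by move=> x; apply: cvgD; [exact: CB_continuous|exact: ch].
    have bh2 : bounded_fun (fun x => h1 x + h x).
      have [M [Mreal hM]] := CB_bounded h1.
      exists (M + 1 + d / 2); split; first exact: num_real.
      move=> K MK x _ /=; rewrite (le_trans (ler_normD _ _))// (le_trans _ (ltW MK))//.
      by rewrite lerD// hM// ltrDl.
    pose h2 := MkCB ch2 bh2.
    exists h2; split.
      apply: dW; rewrite ballEmdist/=; apply: (@le_lt_trans _ _ (d / 2)).
        by apply: CB_dist_le => x; rewrite /= opprD addrA subrr add0r normrN.
      by rewrite ltr_pdivrMr// ltr_pMr// ltr1n.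
    (* Every [G] near [T F h2] lies in [S i], so [T F h2] is an interior point. The integral is the
       same because [T F h2] is almost everywhere [T F h1] plus [weight * h]. *)
    apply: filterS (near_ev (T F h2) L rho rho0) => G GT.
    apply: hS; first exact: loc.
    apply: le_lt_trans GT; rewrite le_eqVlt; apply/orP; left; apply/eqP.
    have [mG _] := loc G; have [m1 _] := loc (T F h1); have [m2 _] := loc (T F h2).
    have mw : measurable_fun [set: R] (fun x => weight x * h x).
      apply: measurable_funM; last exact: continuous_measurable_fun.
      by apply: continuous_measurable_fun => x; exact: continuous_oneDsqrV.
    apply: ge0_ae_eq_integral => //.
    + apply: measurable_funTS; apply: measurableT_comp => //; apply/measurable_EFinP.
      by apply: measurable_funB => //; exact: measurable_funD.
    + apply: measurable_funTS; apply: measurableT_comp => //; apply/measurable_EFinP.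
      exact: measurable_funB.
    move: (Tev F h1) (Tev F h2); apply: filterS2 => x -> -> _.
    by rewrite /= mulrDr addrA.
  have [||h [OT AT]] := @baire_metric R (CB R) (@CB_complete R) _ oT dT (T F @^-1` O).
  - by exists h0; rewrite /preimage/= T0.
  - by move/continuousP : (Tcont F); apply.
  by exists (T F h); split => // i _; exact: AT.
- move=> F AF; apply: oscillates_at_ae_oscillates => k.
    have /interior_subset := AF k.*2 I.
    by rewrite /S/= odd_double doubleK expr0.
  have /interior_subset := AF k.*2.+1 I.
  by rewrite /S/= odd_double/= uphalf_double expr1.
Qed.

End generic_space.

(** * The spaces CB and Lp *)

Section CB_space.
Context {R : realType}.
Local Notation mu := (@lebesgue_measure R).
Implicit Types (u v : R -> R) (F G h : CB R) (L e : R) (p : \bar R).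

Lemma weight_ge0 x : 0 <= weight x :> R.
Proof. by rewrite invr_ge0 (le_trans ler01)// oneDsqr_ge1. Qed.

Lemma weight_le1 x : weight x <= 1 :> R.
Proof. exact: oneDsqrV_le1. Qed.

Lemma continuous_weight : continuous (@weight R).
Proof. by move=> x; exact: continuous_oneDsqrV. Qed.

Lemma measurable_weight : measurable_fun [set: R] (@weight R).
Proof. by apply: continuous_measurable_fun; exact: continuous_weight. Qed.

Lemma integral_weight_lty : (\int[mu]_x (weight x)%:E < +oo)%E.
Proof.
have half : (\int[mu]_(x in `[0%R, +oo[) (weight x)%:E < +oo)%E.
  by rewrite integral0y_oneDsqr ltry.
have mw := (measurable_EFinP _ _).2 measurable_weight.
have w0 x : (0 <= (weight x : R)%:E)%E by rewrite lee_fin weight_ge0.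
have halfN : (\int[mu]_(x in `]-oo, 0%R]) (weight x)%:E =
    \int[mu]_(x in `[0%R, +oo[) (weight x)%:E)%E.
  rewrite (@ge0_integration_by_substitution0 R (fun x => (weight x)%:E) mw w0).
  by apply: eq_integral => x _; rewrite /weight /oneDsqr sqrrN.
have mA : measurable (`[0%R : R, +oo[%classic : set (measurableTypeR R)).
  exact: measurable_itv.
rewrite -(setUv `[0%R : R, +oo[%classic) ge0_integral_setU//; last 3 first.
- exact: measurableC.
- exact: measurable_funTS.
- by apply/disj_setPCl.
rewrite lte_add_pinfty//; apply: le_lt_trans half; rewrite -halfN.
apply: ge0_subset_integral => //; [exact: measurableC|exact: measurable_funTS|].
by move=> x /=; rewrite !in_itv/= andbT => /negP; rewrite -ltNge => /ltW.
Qed.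

Definition CB_perturb F h : CB R.
Proof.
apply: (@MkCB R (fun x => F x + weight x * h x)).
  move=> x; apply: cvgD; first exact: CB_continuous.
  by apply: cvgM; [exact: continuous_weight|exact: CB_continuous].
have [M [_ FM]] := CB_bounded F; have [N [_ hN]] := CB_bounded h.
exists (M + 1 + (N + 1)); split; first exact: num_real.
move=> K MK x _ /=; rewrite (le_trans (ler_normD _ _))// (le_trans _ (ltW MK))//.
rewrite lerD//; first by rewrite FM// ltrDl.
rewrite normrM (ger0_norm (weight_ge0 x)) (le_trans (ler_piMl _ (weight_le1 x)))//.
by rewrite hN// ltrDl.
Defined.

Definition CB0 : CB R.
Proof.
apply: (@MkCB R (cst 0)); first exact: cst_continuous.
by exists 0; split => // M M0 x _; rewrite /= normr0 ltW.
Defined.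

Lemma CB_eq F G : F =1 G -> F = G.
Proof.
move=> FG; apply: (@mdist_positivity R (CB R)).
apply/le_anti; rewrite mdist_ge0 andbT.
by apply: CB_dist_le => x; rewrite FG subrr normr0.
Qed.

Lemma CB_oscillation (phi : nat -> LspaceType1 mu) (eps : nat -> R) :
  proper_approximate_identity phi -> (forall n, 0 < eps n) ->
  eps n @[n --> \oo] --> 0 ->
  exists A : set (CB R), [/\ Gdelta A, dense A &
    forall f, A f -> ae_oscillates phi eps f].
Proof.
move=> pphi eps0 epsc.
apply: (generic_oscillation phi eps pphi eps0 epsc (CB R) (@CB_fun R) CB_perturb CB0).
- by move=> F; apply: locally_integrable_continuous => x; exact: CB_continuous.
- move=> F L e e0.
  pose m := fine (mu `[- L, L]%classic).
  have m0 : 0 <= m by rewrite fine_ge0.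
  have mE : mu `[- L, L]%classic = m%:E.
    by rewrite fineK// lebesgue_measure_itv/=; case: ifP => // _; rewrite -EFinB.
  (* Adding 1 avoids a zero denominator, since the interval may be null. *)
  have e1 : 0 < e / (m + 1) by rewrite divr_gt0// ltr_wpDl.
  apply/nbhs_ballP; exists (e / (m + 1)) => //= G; rewrite ballEmdist/= => FG.
  have mGF : measurable_fun [set: R] (fun x => G x - F x).
    by apply: measurable_funB; apply: continuous_measurable_fun;
      exact: CB_continuous.
  apply: (@le_lt_trans _ _ (\int[mu]_(x in `[(- L)%R, L]) (e / (m + 1))%:E)%E).
    apply: ge0_le_integral => //.
    + apply: measurable_funTS; apply: measurableT_comp => //.
      exact: measurableT_comp.
    + move=> x _; rewrite lee_fin distrC.
      by apply: le_trans (CB_dist_ge _ _ _) _; exact: ltW.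
  rewrite integral_cst//= [X in (_ * X)%E](_ : _ = m%:E)//.
  rewrite -EFinM lte_fin mulrAC ltr_pdivrMr ?ltr_wpDl// ltr_pM2l//.
  by rewrite ltrDl.
- by move=> F h; exact: aeW.
(* As the weight is at most 1, perturbing by [h] is 1-Lipschitz in [h]. *)
- move=> F h A /nbhs_ballP[e /= e0 eA]; apply/nbhs_ballP; exists e => //= h' hh'.
  apply: eA; move: hh'; rewrite !ballEmdist/=.
  apply: le_lt_trans; apply: CB_dist_le => x /=.
  rewrite opprD addrACA subrr add0r -mulrBr normrM (ger0_norm (weight_ge0 x)).
  by rewrite (le_trans (ler_piMl _ (weight_le1 x)))//; exact: CB_dist_ge.
- by move=> F; apply: CB_eq => x /=; rewrite mulr0 addr0.
Qed.
End CB_space.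

(** * The Lp spaces, including the infinite exponent *)

Section Lspace_space.
Context {R : realType}.
Local Notation mu := (@lebesgue_measure R).
Variables (p : \bar R) (p1 : (1 <= p)%E).
Implicit Types (u v : R -> R) (F G : LspaceType mu p1) (h : CB R) (L e : R).

(** Hölder's inequality against the indicator of the interval, with the exponents 1 and infinity
    treated directly. It makes local L1 balls open in Lp. *)
Lemma integral_local_le_Lnorm L : exists2 C : R, 0 <= C &
  forall v, measurable_fun [set: R] v ->
    (\int[mu]_(x in `[(- L)%R, L]) `|(v x)%:E| <= C%:E * 'N[mu]_p[EFin \o v])%E.
Proof.
pose m := fine (mu `[- L, L]%classic).
have m0 : 0 <= m by rewrite fine_ge0.
have mE : mu `[- L, L]%classic = m%:E.
  by rewrite fineK// lebesgue_measure_itv/=; case: ifP => // _; rewrite -EFinB.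
case: p p1 => [r r1|_|//]; last first.
  (* A strictly positive constant, so that its product with an infinite essential supremum is
     infinite. *)
  exists (m + 1) => [|v mv]; first by rewrite addr_ge0.
  have muT : (0 < mu [set: R])%E.
    apply: (@lt_le_trans _ _ (mu `[0, 1]%classic)).
      by rewrite lebesgue_measure_itv/= lte_fin ltr01 oppr0 adde0.
    by apply: le_measure; rewrite ?inE.
  rewrite unlock muT; set E := ess_sup _ _.
  have E0 : (0 <= E)%E.
    by apply: ess_sup_gee => //; apply: aeW => x; exact: abse_ge0.
  have vE : \forall x \ae mu, (`|(v x)%:E| <= E)%E by exact: ess_sup_ge.
  move: E E0 vE => [e| |//] e0 ve; last by rewrite gt0_muley ?leey// lte_fin ltr_wpDl.
  rewrite lee_fin in e0.
  apply: (@le_trans _ _ (\int[mu]_(x in `[(- L)%R, L]) e%:E)%E).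
    apply: ae_ge0_le_integral => //.
    + by apply: measurable_funTS; do 2 apply: measurableT_comp => //.
    + by apply: filterS ve.
  rewrite integral_cst//= [X in (_ * X)%E](_ : _ = m%:E)//.
  by rewrite -!EFinM lee_fin mulrC ler_wpM2r// lerDl.
have r0 : 0 < r by rewrite -lte_fin (lt_le_trans _ r1).
have [->|rN1] := eqVneq r 1.
  exists 1 => // v mv; rewrite mul1e Lnorm1.
  apply: ge0_subset_integral => //.
  by do 2 apply: measurableT_comp => //.
have {}r1 : 1 < r by rewrite lt_neqAle eq_sym rN1.
pose q := r / (r - 1).
have q0 : 0 < q by rewrite divr_gt0// subr_gt0.
have rq : r^-1 + q^-1 = 1.
  by rewrite /q invf_div; field; rewrite ?subr_eq0 ?rN1 gt_eqF.
pose I : R -> R := \1_`[- L, L]%classic.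
have mI : measurable_fun [set: R] I.
  by apply: measurable_indic; exact: measurable_itv.
have NI : ('N[mu]_q%:E[EFin \o I] < +oo)%E.
  rewrite unlock; apply: poweR_lty.
  rewrite (eq_integral (fun x : measurableTypeR R => (\1_`[- L, L]%classic x)%:E)) => [|x _].
    rewrite integral_indic//.
    by rewrite setIT [X in (X < _)%E](_ : _ = m%:E)// ltry.
  rewrite /= /I indicE; case: (_ \in _); first by rewrite normr1 powR1.
  by rewrite normr0 powR0// gt_eqF.
exists (fine 'N[mu]_q%:E[EFin \o I]) => [|v mv]; first by rewrite fine_ge0// Lnorm_ge0.
rewrite fineK ?ge0_fin_numE ?Lnorm_ge0//.
have := hoelder mu mv mI r0 q0 rq; rewrite muleC; apply: le_trans.
rewrite Lnorm1 [leLHS]integral_mkcond le_eqVlt; apply/orP; left; apply/eqP.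
apply: eq_integral => x _; rewrite /= /I patchE indicE.
by case: ifPn => _; rewrite ?mulr1// mulr0 normr0.
Qed.

Lemma finite_normD u v : measurable_fun [set: R] u -> measurable_fun [set: R] v ->
  finite_norm mu p u -> finite_norm mu p v -> finite_norm mu p (u \+ v).
Proof.
move=> mu_ mv fu fv; rewrite /finite_norm.
by rewrite (le_lt_trans (eminkowski mu mu_ mv p1))// lte_add_pinfty.
Qed.

Lemma Lspace_distE F G :
  (Lspace_dist F G)%:E = ('N[mu]_p[EFin \o ((F : R -> R) \- (G : R -> R))%R])%E.
Proof.
rewrite /Lspace_dist fineK// ge0_fin_numE ?Lnorm_ge0//.
apply: (finite_normD (F : R -> R) (\- (G : R -> R))).
- exact: (measurable_Lspace F).
- by apply: measurableT_comp => //; exact: (measurable_Lspace G).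
- exact: Lebesgue_finite.
rewrite /finite_norm (_ : _ \o _ = \- (EFin \o (G : R -> R)))%E//.
by rewrite oppe_Lnorm; exact: Lebesgue_finite.
Qed.

Lemma Lspace_ae_eq F G :
  (\forall x \ae mu, (F : R -> R) x = (G : R -> R) x) -> F = G.
Proof.
move=> FG; apply: (@mdist_positivity R (LspaceType mu p1)).
apply: EFin_inj; rewrite [LHS]Lspace_distE.
rewrite (ae_eq_Lnorm (g := cst 0))//.
- by rewrite Lnorm0// gt_eqF// (lt_le_trans _ p1).
- by apply: measurable_funB; [exact: (measurable_Lspace F)|exact: (measurable_Lspace G)].
- by apply: filterS FG => x /= ->; rewrite subrr.
Qed.

(** As [0 < weight <= 1], a power of exponent at least 1 is below the weight itself, which is
    integrable; the essential supremum is at most 1. *)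
Lemma finite_norm_weight : finite_norm mu p (@weight R).
Proof.
rewrite /finite_norm unlock; case: p p1 => [r r1|_|//]; last first.
  case: ifPn => // _; apply: (@le_lt_trans _ _ 1%E); last exact: ltry.
  by apply/ess_supP; apply: aeW => x /=; rewrite lee_fin ger0_norm ?weight_ge0 ?weight_le1.
apply: poweR_lty; apply: le_lt_trans integral_weight_lty.
apply: ge0_le_integral => //.
- by move=> x _; exact: poweR_ge0.
- apply: (@measurableT_comp _ _ _ _ _ _ (fun x => x `^ r)%E) => //.
    exact: measurable_poweR.
  by apply: measurableT_comp => //; apply/measurable_EFinP; exact: measurable_weight.
- by apply/measurable_EFinP; exact: measurable_weight.
move=> x _ /=; rewrite lee_fin ger0_norm ?weight_ge0//.
rewrite -[leRHS]powRr1 ?weight_ge0//; apply: ger_powR; last by rewrite -lee_fin.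
by rewrite weight_le1 andbT lt_neqAle weight_ge0 andbT eq_sym invr_eq0 gt_eqF.
Qed.

(** Gives the Lipschitz continuity of [h |-> F + weight * h] from the uniform norm to the Lp
    norm. *)
Lemma Lnorm_weight_le v (M : R) : measurable_fun [set: R] v -> 0 <= M ->
  (forall x, `|v x| <= M) ->
  ('N[mu]_p[EFin \o (fun x => weight x * v x)%R] <=
   M%:E * 'N[mu]_p[EFin \o @weight R])%E.
Proof.
move=> mv M0 vM.
have W : @weight R \in Lfun mu p.
  rewrite inE; apply/andP; split; rewrite inE; first exact: measurable_weight.
  exact: finite_norm_weight.
have := LnormZ (Lfun_Sub p1 W) M; rewrite /= ger0_norm// => <-.
apply: ae_le_Lnorm => //.
- by apply: measurable_funM => //; exact: measurable_weight.
- by apply: measurable_funM => //; exact: measurable_weight.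
apply: aeW => x /=.
rewrite mulrC !normrM ler_wpM2r//.
by rewrite (ger0_norm M0).
Qed.

Lemma finite_norm_perturb F h :
  finite_norm mu p (fun x => (F : R -> R) x + weight x * h x).
Proof.
apply: (finite_normD (F : R -> R) (fun x => weight x * h x)).
- exact: (measurable_Lspace F).
- by apply: measurable_funM; [exact: measurable_weight|
    apply: continuous_measurable_fun; exact: CB_continuous].
- exact: Lebesgue_finite.
have [M [_ hM]] := CB_bounded h.
apply: (@le_lt_trans _ _ (`|M + 1|%:E * 'N[mu]_p[EFin \o @weight R])%E).
  apply: Lnorm_weight_le => //.
    by apply: continuous_measurable_fun; exact: CB_continuous.
  by move=> x; apply: le_trans (ler_norm _); apply: hM => //; rewrite ltrDl.
by rewrite lte_mul_pinfty// ?lee_fin//; exact: finite_norm_weight.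
Qed.

Lemma Lspace_oscillation (phi : nat -> LspaceType1 mu) (eps : nat -> R) :
  proper_approximate_identity phi -> (forall n, 0 < eps n) ->
  eps n @[n --> \oo] --> 0 ->
  exists A : set (LspaceType mu p1), [/\ Gdelta A, dense A &
    forall F, A F -> ae_oscillates phi eps F].
Proof.
move=> pphi eps0 epsc.
have mF F : measurable_fun [set: R] (F : R -> R) by exact: (measurable_Lspace F).
have mh h : measurable_fun [set: R] (fun x => weight x * h x).
  by apply: measurable_funM; [exact: measurable_weight|
    apply: continuous_measurable_fun; exact: CB_continuous].
(* The perturbed class is selected by choice and known only almost everywhere, which is all that
   [generic_oscillation] asks for. *)
have /choice[T TP] : forall Fh : LspaceType mu p1 * CB R,
    exists G : LspaceType mu p1, \forall x \ae mu,
      (G : R -> R) x = (Fh.1 : R -> R) x + weight x * Fh.2 x.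
  move=> [F h]; apply: Lspace_of_fun; last exact: finite_norm_perturb.
  by apply: measurable_funD; [exact: mF|exact: mh].
pose ev (F : LspaceType mu p1) : R -> R := F.
have near_F F L e : 0 < e -> \forall G \near F,
    (\int[mu]_(x in `[(- L)%R, L]) `|(ev G x - ev F x)%:E| < e%:E)%E.
  move=> e0; have [C C0 CP] := integral_local_le_Lnorm L.
  have e1 : 0 < e / (C + 1) by rewrite divr_gt0// ltr_wpDl.
  apply/nbhs_ballP; exists (e / (C + 1)) => //= G; rewrite ballEmdist/= => FG.
  have mGF : measurable_fun [set: R] ((G : R -> R) \- (F : R -> R)).
    by apply: measurable_funB; exact: mF.
  apply: le_lt_trans (CP _ mGF) _.
  rewrite -Lspace_distE -EFinM lte_fin.
  apply: (@le_lt_trans _ _ (C * (e / (C + 1)))).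
    by rewrite ler_wpM2l// ltW// -[ltLHS]/(mdist G F) metric_sym.
  by rewrite mulrA ltr_pdivrMr ?ltr_wpDl// [C * e]mulrC ltr_pM2l// ltrDl.
apply: (generic_oscillation phi eps pphi eps0 epsc (LspaceType mu p1)
  ev (fun F h => T (F, h)) CB0).
- move=> F; split=> [|L]; first exact: mF.
  apply/integrableP; split.
    by apply: measurable_funTS; apply/measurable_EFinP; exact: mF.
  have [C C0 CP] := integral_local_le_Lnorm L.
  apply: le_lt_trans (CP _ (mF F)) _.
  by rewrite lte_mul_pinfty//; exact: Lebesgue_finite.
- exact: near_F.
- by move=> F h; exact: (TP (F, h)).
- move=> F h A /nbhs_ballP[e /= e0 eA].
  pose W := fine ('N[mu]_p[EFin \o @weight R])%E.
  have W0 : 0 <= W by rewrite fine_ge0// Lnorm_ge0.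
  have WE : ('N[mu]_p[EFin \o @weight R] = W%:E)%E.
    by rewrite fineK// ge0_fin_numE ?Lnorm_ge0//; exact: finite_norm_weight.
  have e1 : 0 < e / (W + 1) by rewrite divr_gt0// ltr_wpDl.
  apply/nbhs_ballP; exists (e / (W + 1)) => //= h' hh'.
  apply: eA; move: hh'; rewrite !ballEmdist/= => hh'.
  rewrite -lte_fin [ltLHS]Lspace_distE.
  have mhh : measurable_fun [set: R] (fun x => h x - h' x).
    by apply: measurable_funB; apply: continuous_measurable_fun;
      exact: CB_continuous.
  rewrite (ae_eq_Lnorm (g := (fun x => weight x * (h x - h' x)) : measurableTypeR R -> R))//; last 3 first.
  - by apply: measurable_funB; exact: mF.
  - by apply: measurable_funM => //; exact: measurable_weight.
  - move: (TP (F, h)) (TP (F, h')); apply: filterS2 => x /= -> ->.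
    by rewrite opprD addrACA subrr add0r -mulrBr.
  apply: le_lt_trans (Lnorm_weight_le _ _ mhh (mdist_ge0 h h') (CB_dist_ge h h')) _.
  rewrite WE -EFinM lte_fin.
  apply: (@le_lt_trans _ _ (e / (W + 1) * W)).
    by rewrite ler_wpM2r// ltW.
  by rewrite mulrAC ltr_pdivrMr ?ltr_wpDl// ltr_pM2l// ltrDl.
- move=> F; apply: Lspace_ae_eq.
  by apply: filterS (TP (F, CB0)) => x ->; rewrite /= mulr0 addr0.
Qed.

End Lspace_space.

Theorem theorem3p12 (R : realType)
    (phi : nat -> LspaceType1 (@lebesgue_measure R)) (eps : nat -> R)
    (phi_proper : proper_approximate_identity phi)
    (eps_gt0 : forall n, 0 < eps n) (eps_cvg0 : eps n @[n --> \oo] --> 0) :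
  (forall (p : \bar R) (p1 : (1 <= p)%E),
     exists A : set (LspaceType (@lebesgue_measure R) p1),
       [/\ Gdelta A, dense A & forall f, A f -> ae_oscillates phi eps f]) /\
  (exists A : set (CB R),
     [/\ Gdelta A, dense A & forall f, A f -> ae_oscillates phi eps f]).
Proof.
split=> [p p1|]; last exact: CB_oscillation.
exact: Lspace_oscillation.
Qed.
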